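(* Let $I=]a,b[$ be a bounded open interval, $n\ge 1$, $\lambda>0$, and $\boldsymbol f\in L^2(I,\mathbb R^n)$. Let $\boldsymbol u$ be the unique minimizer over $L^2(I,\mathbb R^n)$ of \[E(\boldsymbol w)= TV(\boldsymbol w)+\tfrac{1}{2\lambda}\int_I|\boldsymbol w-\boldsymbol f|^2 .\] Suppose that $\boldsymbol f\in BV(U,\mathbb R^n)$ for an open interval $U\subset I$. Then $|\boldsymbol u'|\le|\boldsymbol f'|$ in the sense of Borel measures on $U$, i.e. \[|\boldsymbol u'|(A)\le|\boldsymbol f'|(A)\quad\text{for every Borel set } A\subset U.\]
   Context: For an open interval $\Omega$, the (vectorial) total variation $TV_\Omega\colon L^2(\Omega,\mathbb R^n)\to[0,+\infty]$ is $TV_\Omega(\boldsymbol u)=\sup\{\int_\Omega \boldsymbol u\cdot\boldsymbol\varphi'\colon \boldsymbol\varphi\in C^1_c(\Omega,\mathbb R^n),\ |\boldsymbol\varphi|\le1\}$, where $|\cdot|$ is the Euclidean norm; it equals $|\boldsymbol u'|(\Omega)$ if $\boldsymbol u\in BV(\Omega,\mathbb R^n)$ and $+\infty$ otherwise, and $TV=TV_I$. Here $\boldsymbol u'$ denotes the distributional derivative (an $\mathbb R^n$-valued measure for $BV$ functions) and $|\boldsymbol u'|$ its total variation measure with respect to the Euclidean norm. $E$ is strictly convex and has a unique minimizer, which lies in $BV(I,\mathbb R^n)$. *)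

(* Defs.v *)
From HB Require Import structures.
From mathcomp Require Import all_boot all_order all_algebra.
From mathcomp Require Import all_classical all_reals all_analysis.
Set Implicit Arguments. Unset Strict Implicit. Unset Printing Implicit Defensive.
Import Order.TTheory GRing.Theory Num.Theory.
Import numFieldNormedType.Exports.
Local Open Scope classical_set_scope.
Local Open Scope ring_scope.

(* Vector-valued functions I -> R^n are represented by their n components
   u : 'I_n -> R -> R.  Sets of R carry the Borel sigma-algebra. *)

Section Defs.
Variables (R : realType) (n : nat).
Local Notation mu := (@lebesgue_measure R).

Definition enorm (v : 'I_n -> R) : R := Num.sqrt (\sum_i (v i) ^+ 2).

Definition L2 (O : set R) (u : 'I_n -> R -> R) : Prop :=
  forall i, measurable_fun O (u i) /\
    (\int[mu]_(x in O) ((u i x) ^+ 2)%:E < +oo)%E.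

Definition Cc1 (O : set R) (phi : R -> R) : Prop :=
  (forall x, derivable phi x 1) /\ continuous ((derive1 phi)) /\
  exists K : set R, [/\ compact K, K `<=` O & forall x, ~ K x -> phi x = 0].

Definition testfun (O : set R) : set ('I_n -> R -> R) :=
  [set phi | (forall i, Cc1 O (phi i)) /\ (forall x, enorm (fun i => phi i x) <= 1)].

Definition TV (O : set R) (u : 'I_n -> R -> R) : \bar R :=
  ereal_sup [set (\int[mu]_(x in O) (\sum_i u i x * derive1 (phi i) x)%:E)%E
            | phi in testfun O].

Definition energy (a b lam : R) (f w : 'I_n -> R -> R) : \bar R :=
  (TV `]a, b[%classic w +
   (1 / (2 * lam))%:E *
     \int[mu]_(x in `]a, b[%classic) (enorm (fun i => w i x - f i x) ^+ 2)%:E)%E.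

Definition is_minimizer (a b lam : R) (f u : 'I_n -> R -> R) : Prop :=
  L2 `]a, b[%classic u /\
  forall w, L2 `]a, b[%classic w -> (energy a b lam f u <= energy a b lam f w)%E.

(* R^n-valued finite (signed) Borel measure, component i given as p i - q i *)
Definition vmeas (p q : 'I_n -> {finite_measure set R -> \bar R})
  (A : set R) : 'I_n -> R := fun i => fine (p i A) - fine (q i A).

(* the distributional derivative of u on the open set O is the finite
   R^n-valued measure (p - q) (restricted to O):
   int_O u_i phi' = - int phi d(p_i - q_i) for all phi in C^1_c(O). *)
Definition is_deriv_meas (O : set R) (u : 'I_n -> R -> R)
  (p q : 'I_n -> {finite_measure set R -> \bar R}) : Prop :=
  forall i phi, Cc1 O phi ->
    (\int[mu]_(x in O) (u i x * (derive1 phi) x)%:E =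
     - (\int[p i]_x (phi x)%:E - \int[q i]_x (phi x)%:E))%E.

Definition tvmeas (p q : 'I_n -> {finite_measure set R -> \bar R})
  (A : set R) : \bar R :=
  ereal_sup [set (\sum_(0 <= k <oo) (enorm (vmeas p q (B k)))%:E)%E
            | B in [set B : nat -> set R |
                     [/\ forall k, measurable (B k), trivIset setT B
                       & \bigcup_k B k = A]]].

End Defs.

(* Main.v *)
Require Import Defs.
From HB Require Import structures.
From mathcomp Require Import all_boot all_order all_algebra.
From mathcomp Require Import all_classical all_reals all_analysis.
From mathcomp Require Import measurable_realfun ring lra.
Set Implicit Arguments. Unset Strict Implicit. Unset Printing Implicit Defensive.
Import Order.TTheory GRing.Theory Num.Theory.
Import numFieldNormedType.Exports.
Local Open Scope classical_set_scope.
Local Open Scope ring_scope.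

(* The dual field z of the minimizer u, z' = (u - f) / lam with z(b) = 0,
   satisfies |z| <= 1 (compare u with u - v 1_[y,b[) and u' = z |u'| on U
   (compare u with the function obtained by deleting the part of u' carried by
   an interval).  Hence |u'| is concentrated on the contact set {|z| = 1}.
   There |z|^2 is maximal, which forces z . z'' <= 0 as a measure on the contact
   set, so that |u'| = z . u' = z . f' + lam z . z'' <= z . f' <= |f'|. *)

(** * Integration against finite measures *)

(** Polar decompositions are avoided. The relation u' = z |u'| appears as e . u'(B) <= int_B z . u'
    for every Borel B and every |e| <= 1; optimality yields it on open intervals, and a Stieltjes
    and Dynkin argument for signed set functions carries it to Borel sets. The obstacle is the sign
    of z . z'' on the contact set. That set is closed but may have empty interior, and z' = (u - f)
    / lam may jump, so no pointwise second-order condition makes sense. Chords replace derivatives: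
    for contact points s <= t in U, comparing slopes of z gives z(s) . z''([s, t]) <= C (t - s)
    M([s, t])^2, where M is a finite measure dominating z''. Summed over a grid, the factor t - s
    makes the error vanish with the mesh. In each cell this is applied to the hull of the contact
    points; the rest of the hull lies in a neighbourhood of the contact set that shrinks to
    nothing. *)

Section dominated.
Context {R : realType} d (T : measurableType d) (mu : {measure set T -> \bar R}).

Lemma cvg_Rintegral (D : set T) (f_ : nat -> T -> R) (f g : T -> R) :
  measurable D ->
  (forall n, measurable_fun D (f_ n)) ->
  mu.-integrable D (EFin \o g) ->
  (forall n x, D x -> `|f_ n x| <= g x) ->
  (forall x, D x -> f_ n x @[n --> \oo] --> f x) ->
  \int[mu]_(x in D) f_ n x @[n --> \oo] --> \int[mu]_(x in D) f x.
Proof.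
move=> mD mf_ ig dom cv.
have mf : measurable_fun D f.
  by apply: (@measurable_fun_cvg _ _ _ _ f_).
have [] := @dominated_convergence _ _ _ mu D mD (fun n => EFin \o f_ n)
  (EFin \o f) (EFin \o g).
- by move=> n; apply/measurable_EFinP.
- exact/measurable_EFinP.
- apply: aeW => x Dx; apply: cvg_EFin; first exact: nearW.
  exact: cv.
- by [].
- by apply: aeW => x n Dx; rewrite lee_fin; exact: dom.
move=> intf _ cvi.
apply: fine_cvg.
rewrite fineK//; exact: integrable_fin_num.
Qed.

End dominated.

Section bounded_measurable.
Context {R : realType}.
Implicit Types (p q : {finite_measure set R -> \bar R}) (f g : R -> R).

(** The common class of integrands: integrable against every finite measure and stable under sums
    and products, so linearity of the integrals below needs no condition tied to the measure. *)
Definition bmf g := measurable_fun setT g /\ exists M, forall x, `|g x| <= M.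

Lemma bmf_integrable p g : bmf g -> p.-integrable setT (EFin \o g).
Proof.
move=> [mg [M gM]]; apply: (@le_integrable _ _ _ _ _ _ _ (EFin \o cst `|M|)) => //.
- exact/measurable_EFinP.
- move=> x _ /=; rewrite lee_fin normr_id.
  by apply: le_trans (gM x) _; exact: ler_norm.
- exact: finite_measure_integrable_cst.
Qed.

Lemma bmf_cst (r : R) : bmf (cst r).
Proof. by split; [exact: measurable_cst | exists `|r|]. Qed.

Lemma bmfD f g : bmf f -> bmf g -> bmf (fun x => f x + g x).
Proof.
move=> [mf [M fM]] [mg [N gN]]; split; first exact: measurable_funD.
by exists (M + N) => x; apply: le_trans (ler_normD _ _) _; exact: lerD.
Qed.

Lemma bmfM f g : bmf f -> bmf g -> bmf (fun x => f x * g x).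
Proof.
move=> [mf [M fM]] [mg [N gN]]; split; first exact: measurable_funM.
by exists (M * N) => x; rewrite normrM ler_pM.
Qed.

Lemma bmfZ (r : R) g : bmf g -> bmf (fun x => r * g x).
Proof. by apply: bmfM; exact: bmf_cst. Qed.

Lemma bmfN g : bmf g -> bmf (fun x => - g x).
Proof.
move=> [mg [N gN]]; split; first exact: measurableT_comp.
by exists N => x; rewrite normrN.
Qed.

Lemma bmfB f g : bmf f -> bmf g -> bmf (fun x => f x - g x).
Proof. by move=> bf bg; apply: bmfD => //; exact: bmfN. Qed.

Lemma bmf_indic (A : set R) : measurable A -> bmf \1_A.
Proof.
move=> mA; split; first exact: measurable_indic.
by exists 1 => x; rewrite indicE; case: (x \in A); rewrite ?normr1 ?normr0.
Qed.

Lemma bmf_continuous g M : continuous g -> (forall x, `|g x| <= M) -> bmf g.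
Proof.
by move=> cg gM; split; [exact: continuous_measurable_fun | exists M].
Qed.

Lemma bmf_sum (I : finType) (h : I -> R -> R) :
  (forall i, bmf (h i)) -> bmf (fun x => \sum_i h i x).
Proof.
move=> bh; elim: (index_enum I) => [|i s ih].
  rewrite [X in bmf X](_ : _ = cst 0); first exact: bmf_cst.
  by apply/funext => x; rewrite big_nil.
rewrite [X in bmf X](_ : _ = (fun x => h i x + \sum_(j <- s) h j x)).
  exact: bmfD.
by apply/funext => x; rewrite big_cons.
Qed.

Lemma bmf_norm g : bmf g -> bmf (fun x => `|g x|).
Proof.
move=> [mg [N gN]]; split; first exact: measurableT_comp.
by exists N => x; rewrite normr_id.
Qed.

(** [sint] integrates against the signed measure p - q, [nint] against p + q, which dominates its
    variation and serves to bound error terms. *)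
Definition sint p q g := \int[p]_x g x - \int[q]_x g x.
Definition nint p q g := \int[p]_x g x + \int[q]_x g x.

Lemma Rint_bmfD p f g : bmf f -> bmf g ->
  \int[p]_x (f x + g x) = \int[p]_x f x + \int[p]_x g x.
Proof. by move=> bf bg; rewrite RintegralD//; exact: bmf_integrable. Qed.

Lemma Rint_bmfZ p r g : bmf g -> \int[p]_x (r * g x) = r * \int[p]_x g x.
Proof. by move=> bg; rewrite RintegralZl//; exact: bmf_integrable. Qed.

Lemma Rint_bmf_le p f g : bmf f -> bmf g -> (forall x, f x <= g x) ->
  \int[p]_x f x <= \int[p]_x g x.
Proof. by move=> bf bg fg; apply: le_Rintegral => //; exact: bmf_integrable. Qed.

Lemma Rint_bmf_cvg p (g_ : nat -> R -> R) g M :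
  (forall n, measurable_fun setT (g_ n)) ->
  (forall n x, `|g_ n x| <= M) ->
  (forall x, g_ n x @[n --> \oo] --> g x) ->
  \int[p]_x g_ n x @[n --> \oo] --> \int[p]_x g x.
Proof.
move=> mg gM cg; apply: (@cvg_Rintegral _ _ _ _ setT _ _ (cst M)) => //.
exact: finite_measure_integrable_cst.
Qed.

Lemma sintD p q f g : bmf f -> bmf g ->
  sint p q (fun x => f x + g x) = sint p q f + sint p q g.
Proof. by move=> bf bg; rewrite /sint !Rint_bmfD//; lra. Qed.

Lemma sintZ p q r g : bmf g -> sint p q (fun x => r * g x) = r * sint p q g.
Proof. by move=> bg; rewrite /sint !Rint_bmfZ//; lra. Qed.

Lemma nintD p q f g : bmf f -> bmf g ->
  nint p q (fun x => f x + g x) = nint p q f + nint p q g.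
Proof. by move=> bf bg; rewrite /nint !Rint_bmfD//; lra. Qed.

Lemma nintZ p q r g : bmf g -> nint p q (fun x => r * g x) = r * nint p q g.
Proof. by move=> bg; rewrite /nint !Rint_bmfZ//; lra. Qed.

Lemma nint_le p q f g : bmf f -> bmf g -> (forall x, f x <= g x) ->
  nint p q f <= nint p q g.
Proof. by move=> bf bg fg; rewrite lerD// Rint_bmf_le. Qed.

Lemma sint_cvg p q (g_ : nat -> R -> R) g M :
  (forall n, measurable_fun setT (g_ n)) ->
  (forall n x, `|g_ n x| <= M) ->
  (forall x, g_ n x @[n --> \oo] --> g x) ->
  sint p q (g_ n) @[n --> \oo] --> sint p q g.
Proof. by move=> mg gM cg; apply: cvgB; exact: Rint_bmf_cvg gM cg. Qed.

Lemma nint_cvg p q (g_ : nat -> R -> R) g M :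
  (forall n, measurable_fun setT (g_ n)) ->
  (forall n x, `|g_ n x| <= M) ->
  (forall x, g_ n x @[n --> \oo] --> g x) ->
  nint p q (g_ n) @[n --> \oo] --> nint p q g.
Proof. by move=> mg gM cg; apply: cvgD; exact: Rint_bmf_cvg gM cg. Qed.

Lemma sint_norm_le p q g : bmf g -> `|sint p q g| <= nint p q (fun x => `|g x|).
Proof.
move=> bg; apply: le_trans (ler_normB _ _) _.
by apply: lerD; apply: le_normr_Rintegral => //; exact: bmf_integrable.
Qed.

Lemma Rint_indic p (A : set R) : measurable A -> \int[p]_x \1_A x = fine (p A).
Proof. by move=> mA; rewrite /Rintegral integral_indic// setIT. Qed.

End bounded_measurable.

(** * Signed set functions on the line *)

Section signed_set_functions.
Context {R : realType}.
Implicit Types (m : set R -> R) (A B : set R).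

(** This is pointwise convergence of the indicators, hence suited to dominated convergence; it
    covers increasing unions, shrinking intervals and vanishing neighbourhoods alike. *)
Definition setcvg (F : nat -> set R) A :=
  forall x, exists N, forall n, (N <= n)%N -> (F n x <-> A x).

(** Real-valued signed measures, in a form stable under sums and restriction; countable additivity
    is the case where [F] consists of partial unions. *)
Definition smeas m :=
  (forall A B, measurable A -> measurable B -> A `&` B = set0 ->
    m (A `|` B) = m A + m B) /\
  (forall (F : nat -> set R) A, (forall n, measurable (F n)) -> measurable A ->
    setcvg F A -> m (F n) @[n --> \oo] --> m A).

Lemma smeas0 m : smeas m -> m set0 = 0.
Proof.
move=> [mU _]; have := mU set0 set0 measurable0 measurable0 (setI0 _).
by rewrite setU0; lra.
Qed.

Lemma smeas_setI m E : measurable E -> smeas m -> smeas (fun A => m (A `&` E)).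
Proof.
move=> mE [mU mc]; split=> [A B mA mB AB|F A mF mA cA].
  rewrite setIUl mU//; [exact: measurableI|exact: measurableI|].
  by rewrite setIACA AB set0I.
apply: mc => [n||x]; [exact: measurableI|exact: measurableI|].
by have [N cN] := cA x; exists N => n /cN [h1 h2]; split=> -[/=]; split; auto.
Qed.

Lemma setcvg_bigcup (F : nat -> set R) :
  (forall k l, (k <= l)%N -> F k `<=` F l) -> setcvg F (\bigcup_n F n).
Proof.
move=> ndF x; have [[N _ FN]|h] := pselect ((\bigcup_n F n) x).
  exists N => n Nn; split=> _; first by exists N.
  exact: (ndF N n).
by exists 0%N => n _; split => // Fn; exfalso; apply: h; exists n.
Qed.

Lemma smeas_bigsetU m (F : nat -> set R) n : smeas m ->
  (forall k, measurable (F k)) -> trivIset setT F ->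
  m (\big[setU/set0]_(k < n) F k) = \sum_(k < n) m (F k).
Proof.
move=> sm mF tF; elim: n => [|n ih]; first by rewrite !big_ord0 smeas0.
rewrite !big_ord_recr/= -ih; apply: sm.1 => //.
  by apply: bigsetU_measurable => k _.
rewrite -bigcup_mkord -subset0 => x [[k /= kn Fk] Fn].
by move: kn; rewrite (tF k n I I) ?ltnn//; exists x.
Qed.

(* m and the Stieltjes measure of x |-> m ]s, x] agree on half-open intervals. *)
Lemma smeas_nonneg m s t : s <= t -> smeas m ->
  (forall x y, s <= x -> x <= y -> y <= t -> 0 <= m `]x, y]%classic) ->
  forall B, measurable B -> B `<=` `]s, t]%classic -> 0 <= m B.
Proof.
move=> st sm m0.
pose K := `]s, t]%classic : set R.
have mK : measurable K by exact: measurable_itv.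
(* Truncation at [t] makes [F] constant outside the interval, so its Stieltjes measure is a
   candidate for [mI], the restriction of [m] to ]s, t]. *)
pose F x := m `]s, Num.min x t]%classic.
pose mI A := m (A `&` K).
have smI : smeas mI by exact: smeas_setI.
have FE x y : x <= y -> F y = F x + mI `]x, y]%classic.
  move=> xy; rewrite /F /mI -sm.1//; last 2 first.
  - by apply: measurableI => //; exact: measurable_itv.
  - rewrite -subset0 => z [/=]; rewrite !in_itv/= => /andP[_ zx] [/andP[xz _] _].
    by move: zx; rewrite le_min leNgt xz.
  congr m; apply/seteqP; split=> z; rewrite /K/= !in_itv/=.
    move=> /andP[sz]; rewrite !le_min => /andP[zy zt]; rewrite sz zt zy/= andbT.
    by case: (leP z x) => _; [left|right].
  case=> [/andP[sz]|[/andP[xz zy] /andP[sz zt]]].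
    by rewrite !le_min sz => /andP[zx zt]; rewrite zt (le_trans zx xy).
  by rewrite sz le_min zy zt.
have mI0 x y : x <= y -> 0 <= mI `]x, y]%classic.
  move=> xy.
  (* Intersecting with ]s, t] clips both endpoints, which leads back to the hypothesis on
     subintervals. *)
  have -> : mI `]x, y]%classic =
      m `]Num.min (Num.max x s) t, Num.min (Num.max y s) t]%classic.
    congr m; apply/seteqP; split=> z; rewrite /K/= !in_itv/=.
      move=> [/andP[xz zy] /andP[sz zt]].
      by rewrite gt_min gt_max xz sz/= le_min le_max zy zt.
    rewrite gt_min gt_max le_min le_max => /andP[+ /andP[zys zt]].
    rewrite [t < z]ltNge zt orbF => /andP[xz sz]; rewrite xz sz; split=> //.
    by move: zys; rewrite [z <= s]leNgt sz orbF.
  apply: m0.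
  - by rewrite le_min le_max lexx orbT st.
  - by rewrite le_min2// le_max2.
  - by rewrite ge_min lexx orbT.
have ndF : nondecreasing F.
  by move=> x y xy; rewrite (FE _ _ xy) lerDl mI0.
have rcF : right_continuous F.
  move=> x; apply/cvg_at_rightP => u [ux cu].
  apply: sm.2 => [n||z]; [exact: measurable_itv|exact: measurable_itv|].
  have [zx|xz] := leP z x.
    exists 0%N => n _ /=; rewrite !in_itv/= !le_min zx.
    by rewrite (le_trans zx (ltW (ux n))).
  have /cvgrPdist_lt/(_ (z - x)) := cu.
  rewrite subr_gt0 => /(_ xz)[N _ hN].
  exists N => n Nn /=; rewrite !in_itv/= !le_min [z <= x]leNgt xz/= andbF.
  have /= := hN n Nn; rewrite distrC gtr0_norm ?subr_gt0// ltrD2r => uz.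
  by rewrite leNgt uz/= andbF.
have [FC FCE] : exists FC : cumulative R R, FC =1 F.
  by exists (HB.pack_for (cumulative R R) F (isCumulative.Build R _ R F ndF rcF)).
pose la : {measure set (measurableTypeR R) -> \bar R} :=
  lebesgue_stieltjes_measure FC.
have laE x y : x <= y -> la `]x, y]%classic = (mI `]x, y]%classic)%:E.
  move=> xy.
  apply: etrans (measurable_mu_extE (wlength FC) (is_ocitv x y)) _.
  apply: etrans (wlength_itv_bnd FC false false xy) _.
  by rewrite !FCE (FE _ _ xy) addrAC subrr add0r.
(* The total mass is identified separately: it is finite, which allows the subtraction in the
   complement step below. *)
have laT : la setT = (mI setT)%:E.
  pose T_ n := `](- n%:R), n%:R]%classic : set R.
  have mT n : measurable (T_ n) by exact: measurable_itv.
  have ndT n k : (n <= k)%N -> T_ n `<=` T_ k.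
    move=> nk x /=; rewrite /T_ /= !in_itv/= => /andP[nx xn].
    have nk' : n%:R <= k%:R :> R by rewrite ler_nat.
    by rewrite (le_trans xn nk') andbT; apply: le_lt_trans nx; rewrite lerN2.
  have UT : \bigcup_n T_ n = setT by exact: bigcup_itvT.
  have h1 : la (T_ n) @[n --> \oo] --> la setT.
    rewrite -UT; apply: nondecreasing_cvg_mu => //.
      by rewrite UT.
    by move=> n k nk; apply/subsetPset; exact: ndT.
  have h2 : (mI (T_ n))%:E @[n --> \oo] --> (mI setT)%:E.
    apply: cvg_EFin; first exact: nearW.
    by apply: smI.2 => //; rewrite -UT; exact: setcvg_bigcup.
  apply: (cvg_unique _ h1) => //.
  apply: cvg_trans h2; apply: near_eq_cvg; near=> n.
  by rewrite laE// (@le_trans _ _ 0)// oppr_le0.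
(* As [mI] is not yet known to be nonnegative, agreement spreads by a Dynkin argument: additivity of
   [mI] handles complements and its continuity handles countable disjoint unions. *)
have laP A : measurable A -> la A = (mI A)%:E.
  apply: (@dynkin_induction _ _ (@ocitv R) (fun A => la A = (mI A)%:E)).
  - by [].
  - exact: ocitvI.
  - exact: laT.
  - move=> _ [[x y] _ <-] /=; have [xy|yx] := leP x y; first exact: laE.
    rewrite set_itv_ge; last by rewrite bnd_simp -leNgt ltW.
    by rewrite measure0 smeas0.
  - move=> S mS laS.
    have mIT : mI setT = mI S + mI (~` S).
      by rewrite -smI.1 ?setUCr ?setICr//; exact: measurableC.
    have : la setT = (la S + la (~` S))%E.
      apply: etrans (measureU la mS (measurableC mS) (setICr S)).
      by congr (la _); rewrite setUCr.
    rewrite laT laS mIT; case: (la (~` S)) => //= r.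
    by rewrite -EFinD => -[] /addrI ->.
  - move=> G mG tG laG.
    have h1 := @measure_sigma_additive _ _ _ la G mG tG.
    have h2 : (mI (\big[setU/set0]_(k < n) G k))%:E @[n --> \oo] -->
        (mI (\bigcup_k G k))%:E.
      apply: cvg_EFin; first exact: nearW.
      apply: smI.2 => [n||x].
      + by apply: bigsetU_measurable => k _.
      + exact: bigcup_measurable.
      + have [[N _ GN]|h] := pselect ((\bigcup_n G n) x).
          exists N.+1 => n Nn; split=> _; first by exists N.
          by rewrite -bigcup_mkord; exists N.
        exists 0%N => n _; rewrite -bigcup_mkord; split=> // -[k _ Gk].
        by exfalso; apply: h; exists k.
    apply: (cvg_unique _ h1) => //.
    apply: cvg_trans h2; apply: near_eq_cvg; near=> n.
    rewrite smeas_bigsetU// -sumEFin big_mkord.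
    by apply: eq_bigr => k _; rewrite laG.
move=> B mB BK.
by rewrite -(setIidl BK) -lee_fin -[leRHS](laP B mB) measure_ge0.
Unshelve. all: by end_near.
Qed.

End signed_set_functions.

(** * Vector-valued integrals and total variation *)

Section euclidean.
Context {R : realType} {n : nat}.
Implicit Types v w : 'I_n -> R.

Lemma enorm_ge0 v : 0 <= enorm v.
Proof. exact: sqrtr_ge0. Qed.

Lemma sum_sqr_ge0 v : 0 <= \sum_i v i ^+ 2.
Proof. by apply: sumr_ge0 => i _; exact: sqr_ge0. Qed.

Lemma enorm_sqr v : enorm v ^+ 2 = \sum_i v i ^+ 2.
Proof. by rewrite sqr_sqrtr// sum_sqr_ge0. Qed.

Lemma enorm_le1 v : (enorm v <= 1) = (\sum_i v i ^+ 2 <= 1).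
Proof. by rewrite -enorm_sqr -{2}(expr1n _ 2) ler_sqr ?nnegrE ?enorm_ge0. Qed.

Lemma abs_coord_le_enorm v i : `|v i| <= enorm v.
Proof.
rewrite -ler_sqr ?nnegrE ?enorm_ge0// enorm_sqr real_normK ?num_real//.
by rewrite (bigD1 i)//= lerDl sumr_ge0// => j _; exact: sqr_ge0.
Qed.

Lemma dot_le1 v w : \sum_i v i ^+ 2 <= 1 -> \sum_i w i ^+ 2 <= 1 ->
  \sum_i v i * w i <= 1.
Proof.
move=> v1 w1.
have : 0 <= \sum_i (v i - w i) ^+ 2 by exact: sum_sqr_ge0.
have -> : \sum_i (v i - w i) ^+ 2 =
    \sum_i v i ^+ 2 + \sum_i w i ^+ 2 - 2 * \sum_i v i * w i.
  by rewrite mulr_sumr -big_split -sumrB; apply: eq_bigr => i _ /=; ring.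
lra.
Qed.

Lemma dot_le_enorm v w : \sum_i v i ^+ 2 <= 1 ->
  \sum_i v i * w i <= enorm w.
Proof.
move=> v1; have [w0|w0] := eqVneq (enorm w) 0.
  rewrite big1 ?w0// => i _.
  by have := abs_coord_le_enorm w i; rewrite w0 normr_le0 => /eqP ->; rewrite mulr0.
have w_gt0 : 0 < enorm w by rewrite lt_neqAle eq_sym w0 enorm_ge0.
have := @dot_le1 v (fun i => (enorm w)^-1 * w i) v1.
have -> : \sum_i ((enorm w)^-1 * w i) ^+ 2 = 1.
  under eq_bigr do rewrite exprMn.
  by rewrite -mulr_sumr -enorm_sqr exprVn mulVf// expf_neq0.
move=> /(_ (lexx _)).
under eq_bigr do rewrite mulrCA.
by rewrite -mulr_sumr -ler_pdivlMl ?invr_gt0// invrK mulr1.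
Qed.

Lemma enorm_dual v : exists e : 'I_n -> R,
  \sum_i e i ^+ 2 <= 1 /\ \sum_i e i * v i = enorm v.
Proof.
have [v0|v0] := eqVneq (enorm v) 0.
  exists (fun=> 0); rewrite v0 !big1 ?ler01//.
    by move=> i _; rewrite mul0r.
  by move=> i _; rewrite expr0n.
exists (fun i => (enorm v)^-1 * v i); split.
  under eq_bigr do rewrite exprMn.
  by rewrite -mulr_sumr -enorm_sqr exprVn mulVf// expf_neq0.
under eq_bigr do rewrite -mulrA -expr2.
by rewrite -mulr_sumr -enorm_sqr expr2 mulKf.
Qed.

End euclidean.

Section vector_integrals.
Context {R : realType}.

Lemma smeasD (m1 m2 : set R -> R) : smeas m1 -> smeas m2 ->
  smeas (fun A => m1 A + m2 A).
Proof.
move=> s1 s2; split=> [A B mA mB AB|F A mF mA FA].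
  by rewrite s1.1// s2.1// addrACA.
by apply: cvgD; [exact: s1.2|exact: s2.2].
Qed.

Lemma smeasN (m : set R -> R) : smeas m -> smeas (fun A => - m A).
Proof.
move=> s1; split=> [A B mA mB AB|F A mF mA FA].
  by rewrite s1.1// opprD.
by apply: cvgN; exact: s1.2.
Qed.

Lemma smeas_sum (I : finType) (m : I -> set R -> R) :
  (forall i, smeas (m i)) -> smeas (fun A => \sum_i m i A).
Proof.
move=> sm; split=> [A B mA mB AB|F A mF mA FA].
  by rewrite -big_split; apply: eq_bigr => i _; exact: (sm i).1.
apply: cvg_big => [|i _]; [exact: add_continuous|exact: (sm i).2].
Qed.

Lemma indic_setcvg (F : nat -> set R) A x : setcvg F A ->
  \1_(F n) x @[n --> \oo] --> (\1_A x : R).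
Proof.
move=> /(_ x)[N FN].
apply: cvg_near_cst; exists N => // n /= Nn.
rewrite !indicE; congr (_%:R); congr nat_of_bool.
by apply/idP/idP => /set_mem h; apply/mem_set; apply/(FN n Nn).
Qed.

Lemma indic_setU_disj (A B : set R) : A `&` B = set0 ->
  \1_(A `|` B) = (fun x => \1_A x + \1_B x) :> (R -> R).
Proof.
move=> AB; apply/funext => x; rewrite !indicE in_setU.
have [xA|] := boolP (x \in A); have [xB|] := boolP (x \in B);
  rewrite ?addr0 ?add0r//.
exfalso; have : (A `&` B) x by split; exact/set_mem.
by rewrite AB.
Qed.

Implicit Types (p q : {finite_measure set R -> \bar R}).

Lemma sint_smeas p q g : bmf g ->
  smeas (fun A => sint p q (fun x => g x * \1_A x)).
Proof.
move=> bg; have [mg [M gM]] := bg; split=> [A B mA mB AB|F A mF mA FA].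
  rewrite -sintD; [|by apply: bmfM => //; exact: bmf_indic..].
  congr sint; apply/funext => x; rewrite indic_setU_disj//; ring.
apply: (@sint_cvg _ _ _ _ _ M) => [k|k x|x].
- by have [] : bmf (fun x => g x * \1_(F k) x) by apply: bmfM => //; exact: bmf_indic.
- rewrite normrM; apply: le_trans (gM x).
  rewrite ler_piMr// indicE; case: (x \in F k); rewrite ?normr1 ?normr0//.
- by apply: cvgM; [exact: cvg_cst|exact: indic_setcvg].
Qed.

Lemma nint_smeas p q : smeas (fun A => nint p q \1_A).
Proof.
split=> [A B mA mB AB|F A mF mA FA].
  by rewrite -nintD; [rewrite indic_setU_disj|exact: bmf_indic..].
apply: (@nint_cvg _ _ _ _ _ 1) => [k|k x|x].
- by have [] : bmf (\1_(F k) : R -> R) by exact: bmf_indic.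
- by rewrite indicE; case: (x \in F k); rewrite ?normr1 ?normr0.
- exact: indic_setcvg.
Qed.

Context {n : nat}.
Implicit Types (P Q : 'I_n -> {finite_measure set R -> \bar R}).
Implicit Types (w : 'I_n -> R -> R) (A B : set R).

Definition vint P Q w := \sum_i sint (P i) (Q i) (w i).
Definition vnint P Q (g : R -> R) := \sum_i nint (P i) (Q i) g.
Definition restr w A : 'I_n -> R -> R := fun i x => w i x * \1_A x.

Lemma bmf_restr w A : (forall i, bmf (w i)) -> measurable A ->
  forall i, bmf (restr w A i).
Proof. by move=> bw mA i; apply: bmfM => //; exact: bmf_indic. Qed.

Lemma vintD P Q w w' : (forall i, bmf (w i)) -> (forall i, bmf (w' i)) ->
  vint P Q (fun i x => w i x + w' i x) = vint P Q w + vint P Q w'.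
Proof.
by move=> bw bw'; rewrite -big_split; apply: eq_bigr => i _; rewrite sintD.
Qed.

Lemma vintZ P Q r w : (forall i, bmf (w i)) ->
  vint P Q (fun i x => r * w i x) = r * vint P Q w.
Proof.
by move=> bw; rewrite mulr_sumr; apply: eq_bigr => i _; rewrite sintZ.
Qed.

Lemma vint_norm_le P Q w g : (forall i, bmf (w i)) -> bmf g ->
  (forall i x, `|w i x| <= g x) -> `|vint P Q w| <= vnint P Q g.
Proof.
move=> bw bg wg; apply: le_trans (ler_norm_sum _ _ _) _.
apply: ler_sum => i _; apply: le_trans (sint_norm_le _ _ (bw i)) _.
by apply: nint_le => //; exact: bmf_norm.
Qed.

Lemma vint_smeas P Q w : (forall i, bmf (w i)) ->
  smeas (fun A => vint P Q (restr w A)).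
Proof. by move=> bw; apply: smeas_sum => i; exact: sint_smeas. Qed.

Lemma vnint_smeas P Q : smeas (fun A => vnint P Q \1_A).
Proof. by apply: smeas_sum => i; exact: nint_smeas. Qed.

Lemma vnint_le P Q f g : bmf f -> bmf g -> (forall x, f x <= g x) ->
  vnint P Q f <= vnint P Q g.
Proof. by move=> bf bg fg; apply: ler_sum => i _; exact: nint_le. Qed.

Lemma vnint_indic_le P Q A B : measurable A -> measurable B -> A `<=` B ->
  vnint P Q \1_A <= vnint P Q \1_B.
Proof.
move=> mA mB AB; apply: vnint_le; [exact: bmf_indic|exact: bmf_indic|move=> x].
rewrite !indicE ler_nat; have [/set_mem xA|_] := boolP (x \in A) => //.
by rewrite mem_set//; exact: AB.
Qed.

Lemma vnintZ P Q r g : bmf g ->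
  vnint P Q (fun x => r * g x) = r * vnint P Q g.
Proof.
by move=> bw; rewrite mulr_sumr; apply: eq_bigr => i _; rewrite nintZ.
Qed.

Lemma vnint_ge0 P Q A : 0 <= vnint P Q \1_A.
Proof.
by apply: sumr_ge0 => i _; apply: addr_ge0; apply: Rintegral_ge0 => x _;
  rewrite indicE.
Qed.

Lemma vint_cst P Q (e : 'I_n -> R) A : measurable A ->
  vint P Q (restr (fun i => cst (e i)) A) = \sum_i e i * vmeas P Q A i.
Proof.
move=> mA; apply: eq_bigr => i _; rewrite sintZ; last exact: bmf_indic.
by rewrite /sint !Rint_indic.
Qed.

(** Freezing [w] at a constant costs at most its oscillation times the mass of P + Q. This serves
    both on the cells of a partition and on short intervals. *)
Lemma vint_restr_cst_le P Q w (e : 'I_n -> R) r A : (forall i, bmf (w i)) ->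
  measurable A -> (forall i x, A x -> `|w i x - e i| <= r) ->
  `|vint P Q (restr w A) - \sum_i e i * vmeas P Q A i| <= r * vnint P Q \1_A.
Proof.
move=> bw mA wr.
have bd i : bmf (fun x => w i x - e i).
  by apply: bmfB => //; exact: bmf_cst.
have -> : vint P Q (restr w A) =
    vint P Q (restr (fun i x => w i x - e i) A) +
    vint P Q (restr (fun i => cst (e i)) A).
  rewrite -vintD; [|exact: bmf_restr|]; last first.
    by apply: bmf_restr => // i; exact: bmf_cst.
  by congr vint; apply/funext => i; apply/funext => x; rewrite /restr/=; ring.
rewrite vint_cst// addrK -vnintZ; last exact: bmf_indic.
apply: vint_norm_le; [exact: bmf_restr|by apply: bmfZ; exact: bmf_indic|].
move=> i x; rewrite /restr indicE; have [/set_mem xA|_] := boolP (x \in A).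
  by rewrite !mulr1 wr.
by rewrite !mulr0 normr0.
Qed.

End vector_integrals.

Lemma le_harmonicP {R : realType} (x y C : R) :
  (forall N : nat, x <= y + N.+1%:R^-1 * C) -> x <= y.
Proof.
move=> h; have : y + harmonic N * C @[N --> \oo] --> y.
  rewrite -[X in _ --> X]addr0 -[X in _ --> _ + X](mul0r C).
  by apply: cvgD; [exact: cvg_cst|apply: cvgM; [exact: cvg_harmonic|exact: cvg_cst]].
by move/cvgr_to_ge; apply; exact: nearW.
Qed.

(** * Duality between fields of norm at most 1 and the total variation measure *)

Section total_variation_measure.
Context {R : realType} {n : nat}.
Implicit Types (P Q : 'I_n -> {finite_measure set R -> \bar R}).
Implicit Types (w : 'I_n -> R -> R) (A : set R).

(** The terms are nonnegative, so the series is bounded as soon as its partial sums are, and only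
    finitely many cells matter. *)
Lemma tvmeas_le P Q A (c : \bar R) :
  (forall (B : nat -> set R) K, (forall k, measurable (B k)) ->
    trivIset setT B -> \bigcup_k B k = A ->
    ((\sum_(k < K) enorm (vmeas P Q (B k)))%:E <= c)%E) ->
  (tvmeas P Q A <= c)%E.
Proof.
move=> h; apply: ge_ereal_sup => _ [B [mB tB UB] <-].
apply: lime_le.
  by apply: is_cvg_nneseries => k _ _; rewrite lee_fin enorm_ge0.
by apply: nearW => K; rewrite big_mkord sumEFin; exact: h.
Qed.

Lemma tvmeas_ge P Q A (B : nat -> set R) K : (forall k, measurable (B k)) ->
  trivIset setT B -> \bigcup_k B k = A ->
  ((\sum_(k < K) enorm (vmeas P Q (B k)))%:E <= tvmeas P Q A)%E.
Proof.
move=> mB tB UB; apply: le_trans (ereal_sup_ubound _); last by exists B.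
rewrite -sumEFin -[leLHS](big_mkord xpredT (fun k => (enorm (vmeas P Q (B k)))%:E)).
by apply: nneseries_lim_ge => k _ _; rewrite lee_fin enorm_ge0.
Qed.

Lemma tvmeas_ge0 P Q A : measurable A -> (0 <= tvmeas P Q A)%E.
Proof.
move=> mA; have := @tvmeas_ge P Q A (fun k => if k == 0%N then A else set0) 0.
rewrite big_ord0; apply.
- by move=> k; case: ifP.
- by move=> [|i] [|j] _ _ //= [x []].
- apply/seteqP; split=> [x [[|k] _]//|x Ax].
  by exists 0%N.
Qed.

Lemma measurable_floor_eq (g : R -> R) (z : int) : measurable_fun setT g ->
  measurable [set x | Num.floor (g x) = z].
Proof.
move=> mg.
have -> : [set x | Num.floor (g x) = z] = setT `&` g @^-1` `[z%:~R, (z + 1)%:~R[%classic.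
  apply/seteqP; split=> x /=; rewrite in_itv/=.
    by move=> <-; split=> //; exact: floor_itv.
  by move=> [_ /andP[zx xz]]; apply: floor_def; rewrite zx xz.
by apply: mg => //; exact: measurable_itv.
Qed.

Section small_oscillation_partition.
Variables (N : nat) (w : 'I_n -> R -> R) (A : set R).
Hypothesis bw : forall i, bmf (w i).
Hypothesis mA : measurable A.

Let code x : {ffun 'I_n -> int} := [ffun i => Num.floor (N.+1%:R * w i x)].
Let B k := A `&` [set x | pickle (code x) = k].

Lemma small_oscillation_partition : exists B : nat -> set R,
  [/\ forall k, measurable (B k), trivIset setT B, \bigcup_k B k = A &
    forall k i x y, B k x -> B k y -> `|w i x - w i y| <= N.+1%:R^-1].
Proof.
exists B; split.
- move=> k; apply: measurableI => //.
  have [[f fk]|nof] := pselect (exists f : {ffun 'I_n -> int}, pickle f = k).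
    have -> : [set x | pickle (code x) = k] =
        \bigcap_(i in [set: 'I_n]) [set x | Num.floor (N.+1%:R * w i x) = f i].
      apply/seteqP; split=> x /=.
        rewrite -fk => /(pcan_inj pickleK) <- i _ /=.
        by rewrite ffunE.
      move=> h; rewrite -fk; congr pickle; apply/ffunP => i.
      by rewrite ffunE; exact: h.
    apply: fin_bigcap_measurable; first exact: finite_finset.
    by move=> i _; apply: measurable_floor_eq; have [] := bmfZ N.+1%:R (bw i).
  rewrite [X in measurable X](_ : _ = set0)//.
  by apply/seteqP; split=> x //= xk; apply: nof; exists (code x).
- by move=> i j _ _ [x [[_ /= <-] [_ /= <-]]].
- apply/seteqP; split=> [x [k _ []]//|x Ax].
  by exists (pickle (code x)).
- move=> k i x y [_ /= xk] [_ /= yk].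
  have /ffunP/(_ i) : code x = code y by apply: (pcan_inj pickleK); rewrite xk.
  rewrite !ffunE => xy.
  have N0 : 0 < N.+1%:R :> R by rewrite ltr0n.
  rewrite -(ler_pM2l N0) divff ?gt_eqF// -[X in X * _]gtr0_norm// -normrM mulrBr.
  have := floor_itv (N.+1%:R * w i x).
  have := floor_itv (N.+1%:R * w i y).
  rewrite xy => /andP[y1 y2] /andP[x1 x2].
  move: x2 y2; rewrite !intrD => x2 y2.
  by rewrite ler_norml; lra.
Qed.

End small_oscillation_partition.

(** On a cell of small oscillation [w] is nearly a constant vector [e] with |e| <= 1, so the
    integral there is at most the norm of the measure of the cell plus [N.+1^-1] times its mass. Sum
    over finitely many cells, exhaust [A], then let [N] grow. *)
Lemma vint_le_tvmeas P Q w A : (forall i, bmf (w i)) -> measurable A ->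
  (forall x, \sum_i w i x ^+ 2 <= 1) ->
  ((vint P Q (restr w A))%:E <= tvmeas P Q A)%E.
Proof.
move=> bw mA w1; have := tvmeas_ge0 P Q mA; case E : (tvmeas P Q A) => [r||]//.
  move=> _; rewrite lee_fin; set C := vnint P Q \1_A.
  suff h N : vint P Q (restr w A) <= r + N.+1%:R^-1 * C.
    exact: le_harmonicP h.
  have [B [mB tB UB wB]] := @small_oscillation_partition N w A bw mA.
  pose U K := \big[setU/set0]_(k < K) B k.
  have mU K : measurable (U K) by apply: bigsetU_measurable => k _.
  have cU : setcvg U A.
    rewrite -UB (_ : \bigcup_k B k = \bigcup_K U K).
      apply: setcvg_bigcup => k l kl x.
      rewrite /U -!bigcup_mkord => -[j /= jk Bj]; exists j => //=.
      exact: leq_trans kl.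
    apply/seteqP; split=> x [k _ kx].
      by exists k.+1 => //; rewrite /U -bigcup_mkord; exists k => /=.
    by move: kx; rewrite /U -bigcup_mkord => -[j _ Bj]; exists j.
  have cv : vint P Q (restr w (U K)) @[K --> \oo] --> vint P Q (restr w A).
    exact: (vint_smeas P Q bw).2.
  apply: (cvgr_to_le cv); apply: nearW => K.
  rewrite /U (smeas_bigsetU K (vint_smeas P Q bw) mB tB).
  have := tvmeas_ge P Q K mB tB UB; rewrite E lee_fin => EK.
  have CK : \sum_(k < K) vnint P Q \1_(B k) <= C.
    rewrite -(smeas_bigsetU K (vnint_smeas P Q) mB tB).
    apply: vnint_indic_le => //; first exact: mU.
    rewrite -bigcup_mkord -UB => x [k _ kx]; by exists k.
  apply: le_trans (_ : \sum_(k < K) (enorm (vmeas P Q (B k)) +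
      N.+1%:R^-1 * vnint P Q \1_(B k)) <= _); last first.
    by rewrite big_split/= -mulr_sumr lerD// ler_wpM2l// invr_ge0.
  apply: ler_sum => k _.
  (* The constant is the value of [w] at a point of the cell, so an empty cell is treated apart. *)
  have [[y Bky]|B0] := pselect (B k !=set0); last first.
    have -> : B k = set0.
      by rewrite -subset0 => x kx; apply: B0; exists x.
    rewrite (smeas0 (vint_smeas P Q bw)).
    by rewrite addr_ge0 ?enorm_ge0// mulr_ge0 ?invr_ge0 ?vnint_ge0.
  have := vint_restr_cst_le P Q bw (mB k) (fun i x kx => wB k i x y kx Bky).
  rewrite ler_norml lerBlDl => /andP[_ /le_trans]; apply.
  by rewrite lerD2r dot_le_enorm.
by move=> _; exact: leey.
Qed.

End total_variation_measure.

(** * Test functions *)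

Section C1_functions.
Context {R : realType}.
Implicit Types (x h : R).

(** The C1 primitive of the positive part; the hats and cutoffs below are built from its
    translates. *)
Definition sqpos x : R := Num.max 0 x ^+ 2 / 2.

(** The remainder bound is uniform in [x]: it gives the derivative of [sqpos] and also the uniform
    error of [smooth_pos]. *)
Lemma sqpos_taylor x h :
  `|sqpos (x + h) - sqpos x - h * Num.max 0 x| <= h ^+ 2 / 2.
Proof.
rewrite /sqpos; have [x0|x0] := leP 0 x; have [h0|h0] := leP 0 (x + h);
  rewrite ler_norml; apply/andP; split; nra.
Qed.

Lemma is_derive_sqpos x : is_derive x 1 sqpos (Num.max 0 x).
Proof.
have cv : h^-1 *: (sqpos (h *: 1 + x) - sqpos x) @[h --> 0^'] --> Num.max 0 x.
  apply/cvgrPdist_le => e e0; near=> h.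
  have h0 : h != 0 by near: h; exact: nbhs_dnbhs_neq.
  have he : `|h| <= e by near: h; apply: dnbhs0_le.
  rewrite /GRing.scale/= mulr1.
  have -> : Num.max 0 x - h^-1 * (sqpos (h + x) - sqpos x) =
      - (h^-1 * (sqpos (x + h) - sqpos x - h * Num.max 0 x)).
    by rewrite (addrC h x); field.
  rewrite normrN normrM normfV ler_pdivrMl ?normr_gt0//.
  apply: le_trans (sqpos_taylor _ _) _.
  rewrite -real_normK ?num_real// expr2 -mulrA ler_wpM2l//.
  have := normr_ge0 h; lra.
split; first by apply/cvg_ex; exists (Num.max 0 x).
exact: cvg_lim cv.
Unshelve. all: by end_near.
Qed.

Definition C1 (g : R -> R) := (forall x, derivable g x 1) /\ continuous (derive1 g).

Lemma C1_intro (g g' : R -> R) : (forall x, is_derive x 1 g (g' x)) ->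
  continuous g' -> C1 g /\ derive1 g = g'.
Proof.
move=> dg cg'; have e : derive1 g = g'.
  by apply/funext => x; rewrite derive1E; exact: derive_val.
by split; [split; [move=> x; exact: ex_derive|rewrite e]|].
Qed.

Lemma C1_is_derive (g : R -> R) : C1 g -> forall x, is_derive x 1 g (derive1 g x).
Proof. by move=> [dg _] x; rewrite derive1E; exact: derivableP. Qed.

Lemma C1_continuous (g : R -> R) : C1 g -> continuous g.
Proof.
move=> [dg _] x; apply: differentiable_continuous; exact/derivable1_diffP.
Qed.

Lemma C1_cst (r : R) : C1 (cst r) /\ derive1 (cst r) = cst 0 :> (R -> R).
Proof. by apply: C1_intro => x; exact: cst_continuous. Qed.

Lemma C1D (f g : R -> R) : C1 f -> C1 g -> C1 (fun x => f x + g x) /\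
  derive1 (fun x => f x + g x) = (fun x => derive1 f x + derive1 g x).
Proof.
move=> C1f C1g; apply: C1_intro => x.
  by apply: is_deriveD; exact: C1_is_derive.
by apply: cvgD; [exact: C1f.2|exact: C1g.2].
Qed.

Lemma C1M (f g : R -> R) : C1 f -> C1 g -> C1 (fun x => f x * g x) /\
  derive1 (fun x => f x * g x) = (fun x => f x * derive1 g x + g x * derive1 f x).
Proof.
move=> C1f C1g; apply: C1_intro => x.
  by apply: is_deriveM; exact: C1_is_derive.
by apply: cvgD; apply: cvgM; [exact: C1_continuous|exact: C1g.2|
  exact: C1_continuous|exact: C1f.2].
Qed.

Lemma C1_shift (f : R -> R) r : C1 f -> C1 (fun x => f (x - r)) /\
  derive1 (fun x => f (x - r)) = (fun x => derive1 f (x - r)).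
Proof.
move=> C1f; apply: C1_intro => x.
  have -> : (fun x => f (x - r)) = f \o (fun x => x - r) by [].
  have := @is_derive1_comp R f (fun x => x - r) x (derive1 f (x - r)) 1.
  rewrite mulr1; apply.
  - exact: C1_is_derive.
  - by rewrite -[X in is_derive _ _ _ X]subr0; apply: is_deriveB.
apply: continuous_comp; last exact: C1f.2.
by apply: cvgB; [exact: cvg_id|exact: cvg_cst].
Qed.

Lemma C1_sqpos : C1 sqpos /\ derive1 sqpos = Num.max 0.
Proof.
apply: C1_intro => x; first exact: is_derive_sqpos.
by apply: continuous_max; [exact: cvg_cst|exact: cvg_id].
Qed.

End C1_functions.

Section test_functions.
Context {R : realType}.
Implicit Types (O : set R) (phi psi f g : R -> R).

Lemma Cc1_C1 O phi : Cc1 O phi -> C1 phi.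
Proof. by case=> ? []. Qed.

Lemma Cc1_intro O phi K : C1 phi -> compact K -> K `<=` O ->
  (forall x, ~ K x -> phi x = 0) -> Cc1 O phi.
Proof. by move=> [d1 c1] cK KO K0; split=> //; split=> //; exists K. Qed.

Lemma Cc1_subset O O' phi : O `<=` O' -> Cc1 O phi -> Cc1 O' phi.
Proof.
move=> OO' [d1 [c1 [K [cK KO K0]]]]; split=> //; split=> //.
by exists K; split=> //; exact: subset_trans OO'.
Qed.

Lemma Cc1D O phi psi : Cc1 O phi -> Cc1 O psi -> Cc1 O (fun x => phi x + psi x).
Proof.
move=> p1 p2; have [c _] := C1D (Cc1_C1 p1) (Cc1_C1 p2).
move: p1 p2 => [_ [_ [K [cK KO K0]]]] [_ [_ [L [cL LO L0]]]].
apply: (Cc1_intro (K := K `|` L)) => //.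
- exact: compactU.
- by move=> x [/KO|/LO].
- by move=> x /not_orP[nK nL]; rewrite K0// L0// addr0.
Qed.

Lemma Cc1M O f phi : C1 f -> Cc1 O phi -> Cc1 O (fun x => f x * phi x).
Proof.
move=> p1 p2; have [c _] := C1M p1 (Cc1_C1 p2).
move: p2 => [_ [_ [L [cL LO L0]]]].
by apply: (Cc1_intro (K := L)) => // x nL; rewrite L0// mulr0.
Qed.

Lemma Cc1_itv c d s t phi : C1 phi -> c < s -> t < d ->
  (forall x, x <= s -> phi x = 0) -> (forall x, t <= x -> phi x = 0) ->
  Cc1 `]c, d[%classic phi.
Proof.
move=> c1 cs td ps pt; apply: (Cc1_intro (K := `[s, t]%classic)) => //.
- exact: segment_compact.
- move=> x /=; rewrite !in_itv/= => /andP[sx xt].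
  by rewrite (lt_le_trans cs sx) (le_lt_trans xt td).
- move=> x /=; rewrite in_itv/= => /negP; rewrite negb_and -!ltNge.
  by case/orP => [/ltW/ps|/ltW/pt].
Qed.

(** The complement of a compact set is open, so [phi] vanishes near every point outside its
    support. *)
Lemma Cc1_deriv_out O phi : Cc1 O phi ->
  exists K, [/\ compact K, K `<=` O &
    forall x, ~ K x -> phi x = 0 /\ derive1 phi x = 0].
Proof.
move=> [_ [_ [K [cK KO K0]]]]; exists K; split=> // x nK; split; first exact: K0.
rewrite derive1E (@near_eq_derive _ _ _ _ (cst 0) x 1).
  by rewrite -derive1E derive1_cst.
have oK : open (~` K) by apply: closed_openC; apply: compact_closed.
by apply: filterS (open_nbhs_nbhs (conj oK nK)) => y /K0.
Qed.

Lemma compact_support_bounded g K : continuous g -> compact K ->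
  (forall x, ~ K x -> g x = 0) -> exists M, forall x, `|g x| <= M.
Proof.
move=> cg cK K0.
have : compact (g @` K).
  by apply: continuous_compact => //; exact: continuous_subspaceT.
move=> /compact_bounded [M [_ hM]]; exists (`|M| + 1) => x.
have [Kx|nK] := pselect (K x); last by rewrite K0// normr0 addr_ge0.
by apply: hM; [rewrite ltr_pwDr// ler_norm|exists x].
Qed.

Lemma Cc1_bmf O phi : Cc1 O phi -> bmf phi /\ bmf (derive1 phi).
Proof.
move=> p1; have [K [cK KO K0]] := Cc1_deriv_out p1.
have c1 := C1_continuous (Cc1_C1 p1); have c2 := (Cc1_C1 p1).2.
have [M pM] := compact_support_bounded c1 cK (fun x nK => (K0 x nK).1).
have [N pN] := compact_support_bounded c2 cK (fun x nK => (K0 x nK).2).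
by split; [exact: bmf_continuous pM|exact: bmf_continuous pN].
Qed.

Lemma cvg_eventually_eq (u : nat -> R) l N :
  (forall n, (N <= n)%N -> u n = l) -> u n @[n --> \oo] --> l.
Proof. by move=> h; apply: cvg_near_cst; exists N. Qed.

End test_functions.

(** * Trapezoidal functions and their C1 approximation *)

Section hat_functions.
Context {R : realType}.
Implicit Types (x e : R).

Definition pos x : R := Num.max 0 x.

(** The mean of the positive part over [x - e, x]. *)
Definition smooth_pos e x : R := e^-1 * (sqpos x - sqpos (x - e)).

Lemma smooth_pos_close e x : 0 < e -> `|smooth_pos e x - pos x| <= e.
Proof.
move=> e0; have := sqpos_taylor x (- e).
rewrite /smooth_pos -/(pos x) => h.
have -> : e^-1 * (sqpos x - sqpos (x - e)) - pos x =
    - (e^-1 * (sqpos (x - e) - sqpos x - - e * pos x)).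
  by field; rewrite gt_eqF.
rewrite normrN normrM gtr0_norm ?invr_gt0// ler_pdivrMl//.
apply: le_trans h _; rewrite sqrrN; nra.
Qed.

Lemma C1_smooth_pos e : C1 (smooth_pos e) /\
  derive1 (smooth_pos e) = (fun x => e^-1 * (pos x - pos (x - e))).
Proof.
have [c1 d1] := @C1_sqpos R; have [c2 d2] := C1_shift e c1.
have [c3 d3] := C1_cst (- 1 : R).
have [c4 d4] := C1M c3 c2.
have [c5 d5] := C1D c1 c4.
have [c6 d6] := C1_cst (e^-1).
have [c7 d7] := C1M c6 c5.
have E : smooth_pos e = (fun x => cst e^-1 x * (sqpos x + cst (- 1) x * sqpos (x - e))).
  by apply/funext => x; rewrite /smooth_pos/=; ring.
rewrite E; split=> //; rewrite d7 d6 d5 d4 d3 d2 d1; apply/funext => x /=.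
by rewrite /pos; ring.
Qed.

Lemma smooth_pos_le0 e x : 0 < e -> x <= 0 -> smooth_pos e x = 0.
Proof.
move=> e0 x0; rewrite /smooth_pos /sqpos !max_l//; last by lra.
by rewrite subrr mulr0.
Qed.

(** The offset [e / 2] does not depend on [x], so it cancels between the two ends of a ramp, and
    smoothed hats vanish exactly on the far right. *)
Lemma smooth_pos_ge e x : 0 < e -> e <= x -> smooth_pos e x = x - e / 2.
Proof.
move=> e0 x0; rewrite /smooth_pos /sqpos !max_r//; [|lra..].
by field; rewrite gt_eqF.
Qed.

Lemma deriv_smooth_pos_bound e x : 0 < e ->
  `|e^-1 * (pos x - pos (x - e))| <= 1.
Proof.
move=> e0; rewrite normrM gtr0_norm ?invr_gt0// ler_pdivrMl// mulr1 /pos.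
have [x0|x0] := leP 0 x; have [h0|h0] := leP 0 (x - e);
  rewrite ler_norml; apply/andP; split; lra.
Qed.

(** At [x = 0] the quotient is 0 for every [k]. This strict inequality in the limit is what later
    produces the left-open intervals ]x1, x2]. *)
Lemma deriv_smooth_pos_cvg (e0 x : R) : 0 < e0 ->
  (e0 * harmonic k)^-1 * (pos x - pos (x - e0 * harmonic k)) @[k --> \oo] -->
  ((0 < x)%R%:R : R).
Proof.
move=> e00; have [x0|x0] := ltP 0 x; last first.
  apply: (@cvg_eventually_eq _ _ _ 0%N) => k _.
  have h : 0 < e0 * harmonic k :> R by rewrite mulr_gt0// harmonic_gt0.
  by rewrite /pos !max_l ?subrr ?mulr0//; lra.
have : e0 * harmonic k @[k --> \oo] --> (0 : R).
  rewrite -(mulr0 e0); apply: cvgM; [exact: cvg_cst|exact: cvg_harmonic].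
move/cvgrPdist_lt => /(_ _ x0)[N _ hN].
apply: (@cvg_eventually_eq _ _ _ N) => k /hN.
have h : 0 < e0 * harmonic k :> R by rewrite mulr_gt0// harmonic_gt0.
rewrite sub0r normrN gtr0_norm// => hx.
rewrite /pos !max_r; [|lra..].
by rewrite opprB addrC subrK mulVf// gt_eqF.
Qed.

(** The trapezoid that rises on [x1, x2], equals 1 on [x2, y1] and falls on [y1, y2]. Pairing its
    derivative with z' gives the difference of the slopes of z over the two ramps. *)
Definition hat (x1 x2 y1 y2 x : R) : R :=
  (pos (x - x1) - pos (x - x2)) / (x2 - x1) -
  (pos (x - y1) - pos (x - y2)) / (y2 - y1).

Section hat_properties.
Variables (x1 x2 y1 y2 : R).
Hypotheses (x12 : x1 < x2) (xy : x2 <= y1) (y12 : y1 < y2).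

Lemma ramp_bounds (a b x : R) : a < b ->
  0 <= (pos (x - a) - pos (x - b)) / (b - a) <= 1.
Proof.
move=> ab; rewrite ler_pdivlMr ?subr_gt0// mul0r ler_pdivrMr ?subr_gt0// mul1r /pos.
by have [x0|x0] := leP 0 (x - a); have [h0|h0] := leP 0 (x - b);
  apply/andP; split; lra.
Qed.

Lemma ramp_eq0 (a b x : R) : a < b -> x <= a ->
  (pos (x - a) - pos (x - b)) / (b - a) = 0.
Proof.
by move=> ab xa; rewrite /pos !max_l ?subrr ?mul0r//; lra.
Qed.

Lemma ramp_eq1 (a b x : R) : a < b -> b <= x ->
  (pos (x - a) - pos (x - b)) / (b - a) = 1.
Proof.
move=> ab xa; rewrite /pos !max_r; [|lra..].
by field; lra.
Qed.

Lemma hat_bounds x : 0 <= hat x1 x2 y1 y2 x <= 1.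
Proof.
rewrite /hat; have [h|h] := leP x y1.
  by rewrite (ramp_eq0 y12 h) subr0 ramp_bounds.
have /andP[y0 y1'] := ramp_bounds x y12.
rewrite (@ramp_eq1 x1 x2) ?(le_trans xy (ltW h))//.
by apply/andP; split; lra.
Qed.

Lemma hat_eq1 x : x2 <= x -> x <= y1 -> hat x1 x2 y1 y2 x = 1.
Proof. by move=> h1 h2; rewrite /hat (ramp_eq0 y12)// ramp_eq1// subr0. Qed.

Lemma hat_eq0l x : x <= x1 -> hat x1 x2 y1 y2 x = 0.
Proof.
move=> h; rewrite /hat (ramp_eq0 y12) ?(ramp_eq0 x12) ?subrr//.
by rewrite (le_trans h)// (le_trans (ltW x12)).
Qed.

Lemma hat_eq0r x : y2 <= x -> hat x1 x2 y1 y2 x = 0.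
Proof.
move=> h; rewrite /hat (ramp_eq1 y12)// (ramp_eq1 x12) ?subrr//.
by rewrite (le_trans xy)// (le_trans (ltW y12)).
Qed.

Let smooth_hat e x :=
  (x2 - x1)^-1 * (smooth_pos e (x - x1) - smooth_pos e (x - x2)) -
  (y2 - y1)^-1 * (smooth_pos e (x - y1) - smooth_pos e (x - y2)).

Let dsp e x := e^-1 * (pos x - pos (x - e)).

Let C1_smooth_hat e : C1 (smooth_hat e) /\ derive1 (smooth_hat e) =
  (fun x => (x2 - x1)^-1 * (dsp e (x - x1) - dsp e (x - x2)) -
  (y2 - y1)^-1 * (dsp e (x - y1) - dsp e (x - y2))).
Proof.
have [c1 d1] := C1_smooth_pos e.
pose r a b x := cst (b - a)^-1 x *
  (smooth_pos e (x - a) + cst (- 1) x * smooth_pos e (x - b)).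
have ramp a b : C1 (r a b) /\ derive1 (r a b) =
    (fun x => (b - a)^-1 * (dsp e (x - a) - dsp e (x - b))).
  have [c2 d2] := C1_shift a c1.
  have [c3 d3] := C1_shift b c1.
  have [c4 d4] := C1_cst (- 1 : R).
  have [c5 d5] := C1M c4 c3.
  have [c6 d6] := C1D c2 c5.
  have [c7 d7] := C1_cst ((b - a)^-1).
  have [c8 d8] := C1M c7 c6.
  split=> //; rewrite /r d8 d7 d6 d5 d4 d3 d2 d1; apply/funext => x /=.
  by rewrite /dsp; ring.
have [c2 d2] := ramp x1 x2; have [c3 d3] := ramp y1 y2.
have [c4 d4] := C1_cst (- 1 : R).
have [c5 d5] := C1M c4 c3.
have [c6 d6] := C1D c2 c5.
have E : smooth_hat e = (fun x => r x1 x2 x + cst (- 1) x * r y1 y2 x).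
  by apply/funext => x; rewrite /smooth_hat /r/=; ring.
rewrite E; split=> //; rewrite d6 d5 d4 d3 d2; apply/funext => x /=.
by ring.
Qed.

(** Averaging over [x - e, x] enlarges the support to the right only, which explains the asymmetric
    roles of [c] and [d]. *)
Lemma hat_approximation d : y2 < d -> exists (phi : nat -> R -> R) (M : R),
  [/\ forall c k, c < x1 -> Cc1 `]c, d[%classic (phi k),
     forall k x, `|phi k x| <= M /\ `|derive1 (phi k) x| <= M,
     forall x, phi k x @[k --> \oo] --> hat x1 x2 y1 y2 x &
     forall x, derive1 (phi k) x @[k --> \oo] -->
       ((x1 < x)%R%:R - (x2 < x)%R%:R) / (x2 - x1) -
       ((y1 < x)%R%:R - (y2 < x)%R%:R) / (y2 - y1)].
Proof.
move=> yd.
(* Half the room to the right of [y2] keeps every support inside ]c, d[. *)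
have [e0 e0E] : exists e0, e0 = (d - y2) / 2 by eexists.
have e00 : 0 < e0 by rewrite e0E; lra.
pose e k := e0 * harmonic k.
have ek k : 0 < e k by rewrite mulr_gt0// harmonic_gt0.
have eke0 k : e k <= e0.
  by rewrite /e ler_piMr ?(ltW e00)// /harmonic/= invf_le1 ?ltr0n// ler1n.
have ce : e k @[k --> \oo] --> 0.
  rewrite /e -(mulr0 e0); apply: cvgM; [exact: cvg_cst|exact: cvg_harmonic].
(* Each ramp is a difference of two smoothed positive parts, whence the factor 2, divided by its
   width. The same [C] bounds the derivatives, as each [dsp] is at most 1 in absolute value. *)
have [C CE] : exists C, C = 2 * ((x2 - x1)^-1 + (y2 - y1)^-1) by eexists.
have ix : 0 < (x2 - x1)^-1 by rewrite invr_gt0 subr_gt0.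
have iy : 0 < (y2 - y1)^-1 by rewrite invr_gt0 subr_gt0.
have C0 : 0 < C by rewrite CE; lra.
have close k x : `|smooth_hat (e k) x - hat x1 x2 y1 y2 x| <= e k * C.
  have -> : smooth_hat (e k) x - hat x1 x2 y1 y2 x =
    (x2 - x1)^-1 * ((smooth_pos (e k) (x - x1) - pos (x - x1)) -
                    (smooth_pos (e k) (x - x2) - pos (x - x2))) -
    (y2 - y1)^-1 * ((smooth_pos (e k) (x - y1) - pos (x - y1)) -
                    (smooth_pos (e k) (x - y2) - pos (x - y2))).
    by rewrite /smooth_hat /hat; ring.
  apply: le_trans (ler_normB _ _) _.
  rewrite !normrM (gtr0_norm ix) (gtr0_norm iy).
  have b a b : `|smooth_pos (e k) a - pos a - (smooth_pos (e k) b - pos b)| <= 2 * e k.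
    apply: le_trans (ler_normB _ _) _.
    by have := smooth_pos_close a (ek k); have := smooth_pos_close b (ek k); lra.
  have -> : e k * C = (x2 - x1)^-1 * (2 * e k) + (y2 - y1)^-1 * (2 * e k).
    by rewrite CE; ring.
  by apply: lerD; rewrite ler_wpM2l// ltW.
exists (fun k => smooth_hat (e k)), (1 + e0 * C + C); split.
- move=> c k cx; apply: (@Cc1_itv _ _ _ x1 (y2 + e k)) => //.
  + by have [] := C1_smooth_hat (e k).
  + by apply: (@le_lt_trans _ _ (y2 + e0)); [rewrite lerD2l|rewrite e0E; lra].
  + move=> x xx1; have xx2 := le_trans xx1 (ltW x12).
    have xy1 := le_trans xx2 xy; have xy2 := le_trans xy1 (ltW y12).
    by rewrite /smooth_hat !smooth_pos_le0 ?ek ?subr_le0// !subrr !mulr0 subrr.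
  + move=> x yx; have yx2 : e k <= x - y2 by rewrite lerBrDl.
    have yx1 : e k <= x - y1 by rewrite (le_trans yx2)// lerD2l lerN2 ltW.
    have xx2 : e k <= x - x2 by rewrite (le_trans yx1)// lerD2l lerN2.
    have xx1 : e k <= x - x1 by rewrite (le_trans xx2)// lerD2l lerN2 ltW.
    rewrite /smooth_hat !smooth_pos_ge ?ek//; clear -x12 y12.
    by field; rewrite !subr_eq0 !gt_eqF.
- move=> k x; split.
    have := close k x; have /andP[h0 h1] := hat_bounds x.
    have : e k * C <= e0 * C by rewrite ler_wpM2r// ltW.
    by rewrite !ler_norml => ? /andP[? ?]; apply/andP; split; lra.
  have [_ ->] := C1_smooth_hat (e k).
  have b a b : `|dsp (e k) a - dsp (e k) b| <= 2.
    apply: le_trans (ler_normB _ _) _.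
    have := deriv_smooth_pos_bound a (ek k).
    by have := deriv_smooth_pos_bound b (ek k); rewrite /dsp; lra.
  apply: (@le_trans _ _ C); last first.
    by rewrite lerDr addr_ge0// mulr_ge0// ltW.
  apply: le_trans (ler_normB _ _) _.
  rewrite !normrM (gtr0_norm ix) (gtr0_norm iy) CE mulrDr.
  rewrite [2 * _]mulrC [2 * (y2 - _)^-1]mulrC.
  by apply: lerD; rewrite ler_wpM2l// ltW.
- move=> x; apply/cvgrPdist_le => r r0.
  have : e k * C @[k --> \oo] --> 0 * C.
    by apply: cvgM => //; exact: cvg_cst.
  rewrite mul0r => /cvgrPdist_le/(_ _ r0)[N _ hN]; exists N => // k /hN /=.
  rewrite sub0r normrN ger0_norm; last by rewrite mulr_ge0// ltW.
  move=> h.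
  by rewrite distrC; exact: le_trans (close k x) h.
- move=> x.
  have -> : (fun k => derive1 (smooth_hat (e k)) x) = (fun k =>
      (x2 - x1)^-1 * (dsp (e k) (x - x1) - dsp (e k) (x - x2)) -
      (y2 - y1)^-1 * (dsp (e k) (x - y1) - dsp (e k) (x - y2))).
    by apply/funext => k; have [_ ->] := C1_smooth_hat (e k).
  have cd r : dsp (e k) (x - r) @[k --> \oo] --> ((r < x)%R%:R : R).
    by rewrite -subr_gt0; exact: deriv_smooth_pos_cvg.
  rewrite ![_ / _]mulrC.
  by apply: cvgB; (apply: cvgM; [exact: cvg_cst|apply: cvgB; exact: cd]).
Qed.

End hat_properties.
End hat_functions.

(** * Integration by parts against distribution functions *)

Section tail_integral.
Context {R : realType}.
Local Notation mu := (@lebesgue_measure R).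
Implicit Types (g : R -> R) (x y : R).

Definition tail g y : R := \int[mu]_(x in `[y, +oo[) g x.

Lemma tailB g x y : mu.-integrable setT (EFin \o g) -> x <= y ->
  tail g x - tail g y = \int[mu]_(t in `]x, y]) g t.
Proof.
move=> ig xy.
have igS A : measurable A -> mu.-integrable A (EFin \o g).
  by move=> mA; apply: integrableS ig.
have mI (i : interval R) : measurable ([set` i] : set (measurableTypeR R)).
  exact: measurable_itv.
rewrite Rintegral_itv_obnd_cbnd; last exact: igS.
rewrite -Rintegral_itv_bndo_bndc; last exact: igS.
apply/eqP; rewrite subr_eq; apply/eqP.
rewrite /tail -Rintegral_setU//.
- congr Rintegral; rewrite -itv_bndbnd_setU// bnd_simp//.
- by apply: igS; exact: measurableU.
- apply/disj_setPS => z [/=]; rewrite !in_itv/= andbT => /andP[_ zy].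
  by rewrite leNgt zy.
Qed.

Lemma tail_continuous g : mu.-integrable setT (EFin \o g) -> continuous (tail g).
Proof.
move=> ig y.
have AB : y - 1 < y + 1 by lra.
have igS A : measurable A -> mu.-integrable A (EFin \o g).
  by move=> mA; apply: integrableS ig.
have igAB : mu.-integrable `[y - 1, y + 1] (EFin \o g).
  by apply: igS; exact: measurable_itv.
have := parameterized_integral_continuous (ltW AB) igAB.
move=> /(continuous_within_itvP _ AB)[+ _ _].
move=> /(_ y); rewrite in_itv/= => /(_ _) cy.
have {}cy : {for y, continuous (fun x => parameterized_integral mu (y - 1) x g)}.
  by apply: cy; apply/andP; split; lra.
have : (tail g (y - 1) - parameterized_integral mu (y - 1) x g) @[x --> y] -->
    (tail g (y - 1) - parameterized_integral mu (y - 1) y g).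
  by apply: cvgB; [exact: cvg_cst|exact: cy].
have E x : y - 1 <= x ->
    tail g (y - 1) - parameterized_integral mu (y - 1) x g = tail g x.
  move=> yx; have := tailB ig yx; rewrite Rintegral_itv_obnd_cbnd; last first.
    by apply: igS; exact: measurable_itv.
  rewrite /parameterized_integral => <-; lra.
rewrite E; last by lra.
apply: cvg_trans; apply: near_eq_cvg.
near=> x; apply: E; near: x; apply: lt_le_nbhsr; lra.
Unshelve. all: by end_near.
Qed.

Lemma tail_Cc1 (O : set R) phi y : Cc1 O phi -> tail (derive1 phi) y = - phi y.
Proof.
move=> p1; have [K [cK KO K0]] := Cc1_deriv_out p1.
have [M [_ hM]] := compact_bounded cK.
(* [B] lies beyond both the support of [phi] and [y], so the tail is an integral over [y, B] to
   which the fundamental theorem applies. *)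
pose B := Num.max (`|M| + 1) y + 1.
have yB : y < B by rewrite /B ltr_pwDr// le_max lexx orbT.
have out x : B <= x -> phi x = 0 /\ derive1 phi x = 0.
  move=> Bx; apply: K0 => Kx.
  have := hM _ (_ : M < `|M| + 1) x Kx; rewrite ltr_pwDr ?ler_norm// => /(_ isT) xM.
  have : `|M| + 1 < x.
    by apply: lt_le_trans Bx; rewrite /B ltr_pwDr// le_max lexx.
  by move=> /lt_le_trans/(_ (ler_norm x)); rewrite ltNge xM.
have [dphi cdphi] := Cc1_C1 p1.
have cphi := C1_continuous (Cc1_C1 p1).
rewrite /tail.
transitivity (\int[mu]_(x in `[y, B]) (derive1 phi x)).
  rewrite Rintegral_mkcond [RHS]Rintegral_mkcond; apply: eq_Rintegral => x _.
  rewrite /patch !mem_setE !in_itv/= andbT.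
  have [yx/=|//] := leP y x.
  by have [//|/ltW/out[_ ->]] := leP x B.
rewrite /Rintegral (continuous_FTC2 yB (F := phi)).
- by rewrite -EFinB/= (out B (lexx _)).1 sub0r.
- exact: continuous_subspaceT.
- split; first by move=> x _; exact: dphi.
  + by apply: cvg_at_right_filter; exact: cphi.
  + by apply: cvg_at_left_filter; exact: cphi.
- by [].
Qed.

Context (p : {finite_measure set R -> \bar R}) (J : set R).
Hypothesis mJ : measurable J.

Definition cdf_on x : R := fine (p (J `&` `]-oo, x]%classic)).

Lemma cdf_on_bmf : bmf cdf_on.
Proof.
have mI x : measurable (J `&` `]-oo, x]%classic) by exact: measurableI.
split.
  apply: nondecreasing_measurable => // x y xy; rewrite /cdf_on.
  apply: fine_le; [exact: fin_num_measure|exact: fin_num_measure|].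
  by apply: le_measure; rewrite ?inE//; apply: setIS; exact: subset_itvl.
exists (fine (p setT)) => x; rewrite ger0_norm ?fine_ge0//.
apply: fine_le; [exact: fin_num_measure|exact: fin_num_measure|].
by apply: le_measure; rewrite ?inE.
Qed.

(** Both sides are the double integral of g(x) 1_J(y) over the half-plane y <= x, so this
    integration by parts is Fubini. *)
Lemma Rint_cdf_on g : mu.-integrable setT (EFin \o g) ->
  \int[mu]_x (cdf_on x * g x) = \int[p]_y (tail g y * \1_J y).
Proof.
move=> ig.
pose D : set (measurableTypeR R * R) := setT `&` [set z | z.2 <= z.1].
have mD : measurable D.
  by apply: measurable_fun_le => //.
pose f (z : measurableTypeR R * R) : R := g z.1 * (\1_J z.2 * \1_D z).
have mg : measurable_fun setT g by apply/measurable_EFinP; case/integrableP: ig.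
have mf : measurable_fun setT f.
  apply: measurable_funM; first by apply: measurableT_comp.
  apply: measurable_funM; last exact: measurable_indic.
  by apply: measurableT_comp => //; exact: measurable_indic.
have fE x y : f (x, y) = g x * \1_(J `&` `]-oo, x]%classic) y.
  rewrite /f indicI/=; congr (_ * (_ * _)).
  rewrite !indicE; congr (_%:R); congr nat_of_bool.
  by apply/idP/idP => /set_mem h; apply/mem_set; move: h;
    rewrite /D/= in_itv/= => //; case.
have mI x : measurable (J `&` `]-oo, x]%classic) by exact: measurableI.
have inner x : (\int[p]_y (f (x, y))%:E = (cdf_on x * g x)%:E)%E.
  under eq_integral do rewrite fE EFinM.
  rewrite integralZl//; last first.
    by apply: bmf_integrable; exact: bmf_indic.
  by rewrite integral_indic// setIT mulrC EFinM fineK// fin_num_measure.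
have innerN x : (\int[p]_y `|(f (x, y))%:E| = (cdf_on x * `|g x|)%:E)%E.
  under eq_integral.
    move=> y _; rewrite abse_EFin fE normrM (ger0_norm (_ : 0 <= \1_(_) y)); last first.
      by rewrite indicE.
    rewrite EFinM; over.
  rewrite integralZl//; last first.
    by apply: bmf_integrable; exact: bmf_indic.
  by rewrite integral_indic// setIT mulrC EFinM fineK// fin_num_measure.
have [mc [M cM]] := cdf_on_bmf.
have icg : mu.-integrable setT (EFin \o (fun x => cdf_on x * g x)).
  have := @integrableMr _ _ _ mu setT measurableT cdf_on (EFin \o g) mc _ ig.
  apply; exists M; split; first exact: num_real.
  by move=> N MN x _; exact: le_trans (cM x) (ltW MN).
have iF : (mu \x p)%E.-integrable setT (EFin \o f).
  apply/integrable12ltyP; first exact/measurable_EFinP.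
  under eq_integral do rewrite innerN.
  have /integrableP[_] := icg; apply: le_lt_trans.
  rewrite le_eqVlt; apply/orP; left; apply/eqP; apply: eq_integral => x _ /=.
  by rewrite normrM (@ger0_norm _ (cdf_on x))// fine_ge0.
have outer y : (\int[mu]_x (f (x, y))%:E = (tail g y * \1_J y)%:E)%E.
  have mY : measurable (`[y, +oo[%classic : set (measurableTypeR R)).
    exact: measurable_itv.
  have iy : mu.-integrable `[y, +oo[ (EFin \o g).
    by apply: integrableS ig => //; exact: measurable_itv.
  rewrite mulrC EFinM /tail /Rintegral fineK; last first.
    by apply: integrable_fin_num => //; exact: measurable_itv.
  rewrite -(integralZl mY iy).
  rewrite [RHS]integral_mkcond; apply: eq_integral => x _.
  rewrite /patch /f mem_setE in_itv/= andbT !indicE /D.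
  have -> : ((x, y) \in setT `&` [set z : R * R | z.2 <= z.1]) = (y <= x).
    by apply/idP/idP => [/set_mem[]//|yx]; apply/mem_set.
  by case: ifPn; rewrite ?mulr1 ?mulr0 -?EFinM// mulrC.
have := Fubini iF.
under eq_integral do rewrite inner.
under [X in _ = X -> _]eq_integral do rewrite outer.
by rewrite /Rintegral => ->.
Qed.

End tail_integral.

(** * First-order optimality *)

Section square_integrable.
Context {R : realType} (a b : R).
Local Notation mu := (@lebesgue_measure R).
Local Notation I := `]a, b[%classic.
Implicit Types (f g : R -> R).

Definition intI f := mu.-integrable I (EFin \o f).
Definition sqI f := measurable_fun I f /\ intI (fun x => f x ^+ 2).

Lemma measurable_I : measurable (I : set (measurableTypeR R)).
Proof. exact: measurable_itv. Qed.

Lemma mu_I_fin : (mu I < +oo)%E.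
Proof.
by rewrite lebesgue_measure_itv/=; case: ifPn => // _; rewrite -EFinB ltry.
Qed.

Lemma intI_bmf f : bmf f -> intI f.
Proof.
move=> [mf [M fM]]; apply: measurable_bounded_integrable.
- exact: measurable_I.
- exact: mu_I_fin.
- exact: measurable_funTS.
- exists M; split; first exact: num_real.
  by move=> N MN x _; exact: le_trans (fM x) (ltW MN).
Qed.

Lemma intID f g : intI f -> intI g -> intI (fun x => f x + g x).
Proof. by move=> iif ig; apply: (integrableD measurable_I iif ig). Qed.

Lemma intIZ r f : intI f -> intI (fun x => r * f x).
Proof. by move=> iif; apply: (integrableZl measurable_I r iif). Qed.

Lemma intIB f g : intI f -> intI g -> intI (fun x => f x - g x).
Proof. by move=> iif ig; apply: (integrableB measurable_I iif ig). Qed.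

Lemma intI_le f g : measurable_fun I f -> intI g ->
  (forall x, `|f x| <= g x) -> intI f.
Proof.
move=> mf ig fg; apply: (le_integrable measurable_I _ _ ig).
  exact/measurable_EFinP.
move=> x _ /=; rewrite lee_fin; apply: le_trans (fg x) _; exact: ler_norm.
Qed.

Lemma intI_bmfMr f g : intI f -> bmf g -> intI (fun x => f x * g x).
Proof.
move=> iif [mg [M gM]].
apply: (@integrableMl _ _ _ mu I measurable_I (EFin \o f) g iif).
  exact: measurable_funTS.
exists M; split; first exact: num_real.
by move=> N MN x _; exact: le_trans (gM x) (ltW MN).
Qed.

Lemma sqI_int f : sqI f -> intI f.
Proof.
move=> [mf if2]; apply: (@intI_le _ (fun x => 1 + f x ^+ 2)) => //.
  by apply: intID => //; apply: intI_bmf; exact: bmf_cst.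
move=> x; rewrite ler_norml; apply/andP; split; nra.
Qed.

Lemma sqI_bmf f : bmf f -> sqI f.
Proof.
move=> bf; split; first by apply: measurable_funTS; exact: bf.1.
apply: intI_bmf; rewrite (_ : (fun x => f x ^+ 2) = (fun x => f x * f x)).
  exact: bmfM.
by apply/funext => x; rewrite expr2.
Qed.

Lemma sqIM f g : sqI f -> sqI g -> intI (fun x => f x * g x).
Proof.
move=> [mf if2] [mg ig2]; apply: (@intI_le _ (fun x => f x ^+ 2 + g x ^+ 2)).
- exact: measurable_funM.
- exact: intID.
- by move=> x; rewrite ler_norml; apply/andP; split; nra.
Qed.

Lemma sqIB f g : sqI f -> sqI g -> sqI (fun x => f x - g x).
Proof.
move=> sf sg; split; first by apply: measurable_funB; [exact: sf.1|exact: sg.1].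
rewrite (_ : (fun x => _) = (fun x => f x ^+ 2 + g x ^+ 2 - 2 * (f x * g x))).
  by apply: intIB; [apply: intID; [exact: sf.2|exact: sg.2]|apply: intIZ; exact: sqIM].
by apply/funext => x; ring.
Qed.

Lemma rintD f g : intI f -> intI g ->
  \int[mu]_(x in I) (f x + g x) = \int[mu]_(x in I) f x + \int[mu]_(x in I) g x.
Proof. exact: (RintegralD measurable_I). Qed.

Lemma rintB f g : intI f -> intI g ->
  \int[mu]_(x in I) (f x - g x) = \int[mu]_(x in I) f x - \int[mu]_(x in I) g x.
Proof. exact: (RintegralB measurable_I). Qed.

Lemma rintZ r f : intI f ->
  \int[mu]_(x in I) (r * f x) = r * \int[mu]_(x in I) f x.
Proof. exact: (RintegralZl r measurable_I). Qed.

Lemma rintK f : intI f ->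
  (\int[mu]_(x in I) (f x)%:E)%E = (\int[mu]_(x in I) f x)%:E.
Proof. by move=> iif; rewrite fineK//; apply: (integrable_fin_num measurable_I). Qed.

Lemma intI_sum (J : finType) (h : J -> R -> R) : (forall j, intI (h j)) ->
  intI (fun x => \sum_j h j x) /\
  \int[mu]_(x in I) (\sum_j h j x) = \sum_j \int[mu]_(x in I) h j x.
Proof.
move=> ih; elim: (index_enum J) => [|j s [ih1 ih2]].
  rewrite (_ : (fun x => _) = cst 0).
    split; first by apply: intI_bmf; exact: bmf_cst.
    rewrite big_nil; apply: etrans (Rintegral_cst _ measurable_I 0) _.
    by rewrite mul0r.
  by apply/funext => x; rewrite big_nil.
rewrite (_ : (fun x => _) = (fun x => h j x + \sum_(k <- s) h k x)).
  by split; [exact: intID|rewrite big_cons -ih2 -rintD].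
by apply/funext => x; rewrite big_cons.
Qed.

Context {n : nat}.
Implicit Types (u v w D : 'I_n -> R -> R) (phi : 'I_n -> R -> R).

Lemma L2_sqI u : L2 I u -> forall i, sqI (u i).
Proof.
move=> h i; have [mu_ h2] := h i; split=> //.
apply/integrableP; split.
  apply/measurable_EFinP; rewrite (_ : (fun x => _) = (fun x => u i x * u i x)).
    exact: measurable_funM.
  by apply/funext => x; rewrite expr2.
rewrite (_ : (\int[mu]_(x in _) _)%E = (\int[mu]_(x in I) (u i x ^+ 2)%:E)%E)//.
by apply: eq_integral => x _ /=; rewrite ger0_norm// sqr_ge0.
Qed.

Lemma sqI_L2 u : (forall i, sqI (u i)) -> L2 I u.
Proof.
move=> h i; have [m_ h2] := h i; split=> //.
have /integrableP[_] := h2; apply: le_lt_trans.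
rewrite le_eqVlt; apply/orP; left; apply/eqP.
by apply: eq_integral => x _ /=; rewrite ger0_norm// sqr_ge0.
Qed.

Definition dpair u phi := \sum_i \int[mu]_(x in I) (u i x * derive1 (phi i) x).

Lemma dpair_int u phi : (forall i, intI (u i)) -> (forall i, Cc1 I (phi i)) ->
  forall i, intI (fun x => u i x * derive1 (phi i) x).
Proof.
by move=> iu cphi i; apply: intI_bmfMr => //; have [] := Cc1_bmf (cphi i).
Qed.

Lemma TVE u : (forall i, intI (u i)) ->
  TV I u = ereal_sup [set (dpair u phi)%:E | phi in @testfun R n I].
Proof.
move=> iu; rewrite /TV; congr ereal_sup.
apply: eq_imagel => phi [cphi _].
have [iS eS] := intI_sum (dpair_int iu cphi).
by rewrite rintK// eS.
Qed.

Definition sqdist u v := \sum_i \int[mu]_(x in I) (u i x - v i x) ^+ 2.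

Lemma energyE lam (f w : 'I_n -> R -> R) :
  (forall i, sqI (f i)) -> (forall i, sqI (w i)) ->
  energy a b lam f w = (TV I w + (1 / (2 * lam) * sqdist w f)%:E)%E.
Proof.
move=> sf sw; rewrite /energy [in RHS]EFinM; congr (_ + _ * _)%E.
have id i : intI (fun x => (w i x - f i x) ^+ 2).
  by have [] := sqIB (sw i) (sf i).
have [iS eS] := intI_sum id.
rewrite /sqdist -eS -rintK//; apply: eq_integral => x _.
by rewrite enorm_sqr.
Qed.

Lemma dpairB u D t phi : (forall i, intI (u i)) -> (forall i, bmf (D i)) ->
  (forall i, Cc1 I (phi i)) ->
  dpair (fun i x => u i x - t * D i x) phi = dpair u phi - t * dpair D phi.
Proof.
move=> iu bD cphi; rewrite /dpair mulr_sumr -sumrB; apply: eq_bigr => i _.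
have iD j : intI (D j) by exact: intI_bmf.
have i1 := dpair_int iu cphi i; have i2 := dpair_int iD cphi i.
rewrite -rintZ// -rintB//; last exact: intIZ.
congr Rintegral; apply/funext => x; ring.
Qed.

Section optimality.
Variables (lam : R) (f u : 'I_n -> R -> R).
Hypotheses (lam0 : 0 < lam) (L2f : L2 I f) (umin : is_minimizer a b lam f u).

Let sf := L2_sqI L2f.
Let su := L2_sqI umin.1.
Let iu i := sqI_int (su i).

Lemma testfun0 : testfun I (fun (_ : 'I_n) (_ : R) => 0 : R).
Proof.
split=> [i|x].
  apply: (Cc1_intro (K := set0)) => //; last exact: compact0.
  exact: (C1_cst (0 : R)).1.
rewrite enorm_le1 big1 ?ler01// => i _; by rewrite expr0n.
Qed.

Lemma dpair0r w : dpair w (fun (_ : 'I_n) (_ : R) => 0 : R) = 0.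
Proof.
rewrite /dpair big1// => i _.
have -> : (fun x => w i x * derive1 (fun _ : R => 0 : R) x) = cst 0.
  by apply/funext => x; rewrite (C1_cst (0 : R)).2/= mulr0.
by rewrite [LHS](Rintegral_cst _ measurable_I) mul0r.
Qed.

Lemma dpair0l phi : dpair (fun (_ : 'I_n) (_ : R) => 0 : R) phi = 0.
Proof.
rewrite /dpair big1// => i _.
have -> : (fun x => 0 * derive1 (phi i) x) = cst 0.
  by apply/funext => x; rewrite mul0r.
by rewrite [LHS](Rintegral_cst _ measurable_I) mul0r.
Qed.

(** The zero function has finite energy, so the minimizer has finite total variation. *)
Lemma minimizer_TV : exists V, TV I u = V%:E.
Proof.
have TV0 : (0 <= TV I u)%E.
  rewrite TVE//; apply: le_ereal_sup_tmp.
  exists 0%E => //; exists (fun _ _ => 0).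
    exact: testfun0.
  by rewrite dpair0r.
have s0 (i : 'I_n) : sqI (fun _ : R => 0 : R) by apply: sqI_bmf; exact: bmf_cst.
have := umin.2 _ (sqI_L2 s0); rewrite !energyE//.
have -> : TV I (fun (_ : 'I_n) (_ : R) => 0 : R) = 0%E.
  rewrite TVE; last by move=> i; exact: sqI_int (s0 i).
  apply/eqP; rewrite eq_le; apply/andP; split.
    by apply: ge_ereal_sup => _ [phi _ <-]; rewrite lee_fin dpair0l.
  apply: le_ereal_sup_tmp; exists 0%E => //; exists (fun _ _ => 0); first exact: testfun0.
  by rewrite dpair0l.
rewrite add0e; move: TV0; case: (TV I u) => [V| |] //; by exists V.
Qed.

(* from the convexity of TV along the segment u - t D, 0 <= t <= 1 *)
Lemma minimizer_variation (V K : R) D : TV I u = V%:E ->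
  (forall i, bmf (D i)) ->
  (forall phi, testfun I phi -> dpair u phi - dpair D phi <= V + K) ->
  \sum_i \int[mu]_(x in I) ((u i x - f i x) * D i x) <= lam * K.
Proof.
move=> TVu bD hK.
pose S := \sum_i \int[mu]_(x in I) ((u i x - f i x) * D i x).
pose N := \sum_i \int[mu]_(x in I) (D i x ^+ 2).
have sD i : sqI (D i) by exact: sqI_bmf.
have suf i : sqI (fun x => u i x - f i x) by exact: sqIB.
have tD t i : sqI (fun x => u i x - t * D i x).
  by apply: sqIB => //; apply: sqI_bmf; exact: bmfZ.
have distE t : sqdist (fun i x => u i x - t * D i x) f =
    sqdist u f - 2 * t * S + t ^+ 2 * N.
  rewrite /sqdist /S /N !mulr_sumr -sumrB -big_split; apply: eq_bigr => i _ /=.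
  have i1 : intI (fun x => (u i x - f i x) ^+ 2) by exact: (suf i).2.
  have i2 : intI (fun x => (u i x - f i x) * D i x) by exact: sqIM.
  have i3 : intI (fun x => D i x ^+ 2) by exact: (sD i).2.
  have i4 := intIZ (2 * t) i2; have i5 := intIZ (t ^+ 2) i3.
  rewrite -!rintZ// -rintB// -rintD//; last exact: intIB.
  congr Rintegral; apply/funext => x; ring.
have dV phi : testfun I phi -> dpair u phi <= V.
  move=> tphi; rewrite -lee_fin -TVu TVE//.
  by apply: ereal_sup_ubound; exists phi.
(* The first-order inequality up to the quadratic term of the energy, whose factor [t] removes it in
   the limit. *)
have main t : 0 < t -> t <= 1 -> S <= lam * K + t * (N / 2).
  move=> t0 t1.
  (* Each pairing is (1 - t) [dpair u] + t ([dpair u] - [dpair D]), hence at most (1 - t) V + t (V +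
     K). *)
  have TVt : (TV I (fun i x => (u i x - t * D i x)%R) <= (V + t * K)%:E)%E.
    rewrite TVE; last by move=> i; exact: sqI_int (tD t i).
    apply: ge_ereal_sup => _ [phi tphi <-]; rewrite lee_fin dpairB//; last exact: tphi.1.
    have := hK _ tphi; have := dV _ tphi; nra.
  have := umin.2 _ (sqI_L2 (tD t)); rewrite !energyE// TVu distE => h.
  have {h} := le_trans h (leeD2r _ TVt).
  rewrite -!EFinD lee_fin mul1r => h.
  have : 0 <= t * (2 * lam * K - 2 * S + t * N).
    have -> : t * (2 * lam * K - 2 * S + t * N) = (2 * lam) *
      (V + t * K + (2 * lam)^-1 * (sqdist u f - 2 * t * S + t ^+ 2 * N) -
       (V + (2 * lam)^-1 * sqdist u f)) by field; rewrite gt_eqF.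
    by rewrite mulr_ge0 ?subr_ge0// mulr_ge0// ltW.
  by rewrite pmulr_rge0//; lra.
apply: (@le_harmonicP _ _ _ (N / 2)) => k; apply: main.
  by rewrite invr_gt0 ltr0n.
by rewrite invf_le1 ?ltr0n// ler1n.
Qed.

End optimality.
End square_integrable.

(** * From nonnegativity on intervals to nonnegativity on Borel sets *)

Section smeas_intervals.
Context {R : realType}.
Implicit Types (m : set R -> R) (B : set R).

Lemma smeas_ge0_limit m (F : nat -> set R) B : smeas m ->
  (forall k, measurable (F k)) -> measurable B -> setcvg F B ->
  (forall k, 0 <= m (F k)) -> 0 <= m B.
Proof.
move=> sm mF mB FB F0; have cv := sm.2 _ _ mF mB FB.
by apply: (cvgr_to_ge cv); exact: nearW.
Qed.

Lemma harmonic_lt (r : R) : 0 < r ->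
  exists N, forall k, (N <= k)%N -> k.+1%:R^-1 < r.
Proof.
move=> r0; have /cvgrPdist_lt/(_ _ r0)[N _ hN] := @cvg_harmonic R.
exists N => k /hN /=; rewrite sub0r normrN ger0_norm ?invr_ge0//.
Qed.

Lemma smeas_nonneg_open m c d : smeas m ->
  (forall s t, c < s -> s <= t -> t < d -> 0 <= m `]s, t]%classic) ->
  forall B, measurable B -> B `<=` `]c, d[%classic -> 0 <= m B.
Proof.
move=> sm m0 B mB Bcd.
pose K k : set R := `](c + k.+1%:R^-1), (d - k.+1%:R^-1)]%classic.
have mK k : measurable (K k) by exact: measurable_itv.
have h0 k : 0 < k.+1%:R^-1 :> R by rewrite invr_gt0.
apply: (@smeas_ge0_limit m (fun k => B `&` K k)) => //.
- by move=> k; exact: measurableI.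
- move=> x; have [Bx|nB] := pselect (B x); last first.
    by exists 0%N => k _; split => [[]|].
  have := Bcd _ Bx; rewrite /= in_itv/= => /andP[cx xd].
  have [N1 h1] := @harmonic_lt (x - c) ltac:(by rewrite subr_gt0).
  have [N2 h2] := @harmonic_lt (d - x) ltac:(by rewrite subr_gt0).
  exists (maxn N1 N2) => k; rewrite geq_max => /andP[/h1 k1 /h2 k2].
  split=> [[]//|_]; split=> //; rewrite /K/= in_itv/=.
  by rewrite -ltrBrDl k1/= lerBrDl -lerBrDr ltW.
move=> k; have [st|ts] := leP (c + k.+1%:R^-1) (d - k.+1%:R^-1); last first.
  by rewrite /K set_itv_ge ?setI0 ?smeas0// bnd_simp -leNgt ltW.
apply: (smeas_nonneg st sm); [|exact: measurableI|exact: subIsetr].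
move=> x y sx xy yt; apply: m0 => //.
  by apply: lt_le_trans sx; rewrite ltrDl.
by apply: le_lt_trans yt _; rewrite gtrBl.
Qed.

(** A half-open interval is the limit of slightly longer open ones. Open intervals are the form
    delivered by the competitors, whose cutoffs have compact support inside the interval. *)
Lemma smeas_nonneg_oo m c d : smeas m ->
  (forall s t, c <= s -> t <= d -> 0 <= m `]s, t[%classic) ->
  forall B, measurable B -> B `<=` `]c, d[%classic -> 0 <= m B.
Proof.
move=> sm m0; apply: (smeas_nonneg_open sm) => s t cs st td.
(* Scaled by [d - t], so that the enlarged interval never passes [d]. *)
pose e k := (d - t) * k.+1%:R^-1.
have e0 k : 0 < e k by rewrite mulr_gt0 ?invr_gt0// subr_gt0.
have ed k : t + e k <= d.
  rewrite addrC -lerBrDr ler_piMr ?subr_ge0 ?(ltW td)//.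
  by rewrite invf_le1 ?ltr0n// ler1n.
apply: (@smeas_ge0_limit m (fun k => `]s, (t + e k)[%classic)) => //.
- move=> x; have [xt|tx] := leP x t.
    exists 0%N => k _; rewrite /= !in_itv/= xt.
    have -> : x < t + e k by apply: (le_lt_trans xt); rewrite ltrDl.
    by [].
  have [N hN] := @harmonic_lt ((x - t) / (d - t)) ltac:(by rewrite divr_gt0 ?subr_gt0).
  exists N => k /hN hk; rewrite /= !in_itv/=.
  rewrite [x <= t]leNgt tx andbF; split=> // /andP[_].
  rewrite ltNge -lerBrDl => /negP[]; rewrite /e.
  by move: hk; rewrite ltr_pdivlMr ?subr_gt0// mulrC => /ltW.
by move=> k; apply: m0 => //; exact: ltW.
Qed.

End smeas_intervals.

(** * C1 cutoffs increasing to the indicator of an open interval *)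

Section smooth_cutoff.
Context {R : realType}.
Implicit Types (x y s t : R).

Lemma C1_comp (f g : R -> R) : C1 f -> C1 g -> C1 (f \o g).
Proof.
move=> C1f C1g.
have d x : is_derive x 1 (f \o g) (derive1 f (g x) * derive1 g x).
  by apply: is_derive1_comp; exact: C1_is_derive.
have c : continuous (fun x => derive1 f (g x) * derive1 g x).
  move=> x; apply: cvgM; last exact: C1g.2.
  by apply: (@continuous_comp _ _ _ g (derive1 f)); [exact: C1_continuous|exact: C1f.2].
by have [] := C1_intro d c.
Qed.

Lemma C1_affine (r q : R) : C1 (fun x => r * x + q).
Proof.
have d x : is_derive x 1 (fun x => r * x + q) r.
  rewrite -[X in is_derive _ _ _ X]addr0; apply: is_deriveD.
  rewrite -[X in is_derive _ _ _ X]mulr1; exact: is_deriveZ.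
by have [] := C1_intro d (fun x => @cst_continuous _ _ r x).
Qed.

(** The primitive of the triangle of height 1 on [0, 2], which has area 1: a C1 step from 0 to 1. *)
Definition smooth_step y : R := sqpos y - 2 * sqpos (y - 1) + sqpos (y - 2).

Lemma C1_smooth_step : C1 smooth_step.
Proof.
have [c1 _] := @C1_sqpos R.
have [c2 _] := C1_shift 1 c1; have [c3 _] := C1_shift 2 c1.
have [c4 _] := C1_cst (- 2 : R).
have [c5 _] := C1M c4 c2; have [c6 _] := C1D c1 c5; have [c7 _] := C1D c6 c3.
rewrite (_ : smooth_step = (fun x => sqpos x + cst (-2) x * sqpos (x - 1) +
  sqpos (x - 2)))//.
by apply/funext => x; rewrite /smooth_step/=; ring.
Qed.

Lemma smooth_step_bounds y : 0 <= smooth_step y <= 1.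
Proof.
rewrite /smooth_step /sqpos.
by have [h0|h0] := leP 0 y; have [h1|h1] := leP 0 (y - 1);
  have [h2|h2] := leP 0 (y - 2); apply/andP; split; nra.
Qed.

Lemma smooth_step0 y : y <= 0 -> smooth_step y = 0.
Proof. by move=> y0; rewrite /smooth_step /sqpos !max_l; [ring|lra..]. Qed.

Lemma smooth_step1 y : 2 <= y -> smooth_step y = 1.
Proof. by move=> y0; rewrite /smooth_step /sqpos !max_r; [field|lra..]. Qed.

(** The shift by 1 makes the function vanish within distance [k.+1^-1] of either endpoint, so its
    support is compact inside ]s, t[. *)
Definition cutoff s t (k : nat) x : R :=
  smooth_step (k.+1%:R * (x - s) - 1) * smooth_step (k.+1%:R * (t - x) - 1).

Lemma C1_cutoff s t k : C1 (cutoff s t k).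
Proof.
have c1 := C1_comp C1_smooth_step (C1_affine k.+1%:R (- (k.+1%:R * s) - 1)).
have c2 := C1_comp C1_smooth_step (C1_affine (- k.+1%:R) (k.+1%:R * t - 1)).
have [c3 _] := C1M c1 c2.
rewrite (_ : cutoff s t k = (fun x =>
  (smooth_step \o (fun x : R => k.+1%:R * x + (- (k.+1%:R * s) - 1))) x *
  (smooth_step \o (fun x : R => - k.+1%:R * x + (k.+1%:R * t - 1))) x))//.
by apply/funext => x; rewrite /cutoff/=; congr (smooth_step _ * smooth_step _); ring.
Qed.

Lemma cutoff_bounds s t k x : 0 <= cutoff s t k x <= 1.
Proof.
have /andP[a0 a1] := smooth_step_bounds (k.+1%:R * (x - s) - 1).
have /andP[b0 b1] := smooth_step_bounds (k.+1%:R * (t - x) - 1).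
by rewrite mulr_ge0//= mulr_ile1.
Qed.

Lemma Cc1_cutoff s t k : Cc1 `]s, t[%classic (cutoff s t k).
Proof.
have k0 : 0 < k.+1%:R :> R by rewrite ltr0n.
apply: (@Cc1_itv _ _ _ (s + k.+1%:R^-1) (t - k.+1%:R^-1)).
- exact: C1_cutoff.
- by rewrite ltrDl invr_gt0.
- by rewrite ltrBlDr ltrDl invr_gt0.
- move=> x; rewrite -lerBlDl => h; rewrite /cutoff smooth_step0 ?mul0r//.
  by rewrite subr_le0 -ler_pdivlMl// mulr1.
- move=> x; rewrite lerBlDr -lerBlDl => h; rewrite /cutoff mulrC smooth_step0 ?mul0r//.
  by rewrite subr_le0 -ler_pdivlMl// mulr1.
Qed.

Lemma cutoff_cvg s t x : cutoff s t k x @[k --> \oo] --> (\1_(`]s, t[%classic) x : R).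
Proof.
rewrite indicE mem_setE in_itv/=.
have big (r : R) : 0 < r -> exists N, forall k, (N <= k)%N -> 2 <= k.+1%:R * r - 1.
  (* The step reaches 1 at 2 and its argument is shifted by 1, so [k.+1 * r] has to reach 3. *)
  move=> r0; have [N hN] := @harmonic_lt _ (r / 3) ltac:(by rewrite divr_gt0).
  exists N => k /hN; rewrite invf_plt ?posrE ?divr_gt0// => h.
  have k0 : 0 < k.+1%:R :> R by rewrite ltr0n.
  have : k.+1%:R * r > 3.
    by move: h; rewrite invf_div ltr_pdivrMr.
  lra.
have k0 k : 0 <= k.+1%:R :> R by rewrite ler0n.
have [sx|xs] := ltP s x; last first.
  apply: (@cvg_eventually_eq _ _ _ 0%N) => k _.
  rewrite /cutoff smooth_step0 ?mul0r//.
  have : k.+1%:R * (x - s) <= 0 by rewrite mulr_ge0_le0// subr_le0.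
  lra.
have [xt|tx] := ltP x t; last first.
  apply: (@cvg_eventually_eq _ _ _ 0%N) => k _.
  rewrite /cutoff mulrC smooth_step0 ?mul0r//.
  have : k.+1%:R * (t - x) <= 0 by rewrite mulr_ge0_le0// subr_le0.
  lra.
have [N1 h1] := big (x - s) ltac:(by rewrite subr_gt0).
have [N2 h2] := big (t - x) ltac:(by rewrite subr_gt0).
apply: (@cvg_eventually_eq _ _ _ (maxn N1 N2)) => k.
rewrite geq_max => /andP[/h1 k1 /h2 k2].
by rewrite /cutoff !smooth_step1// mul1r.
Qed.

End smooth_cutoff.

(** * The dual field *)

Section derivative_measures.
Context {R : realType} {n : nat}.
Local Notation mu := (@lebesgue_measure R).
Implicit Types (P Q : 'I_n -> {finite_measure set R -> \bar R}).

Lemma deriv_measE (U : set R) (v : 'I_n -> R -> R) P Q i phi :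
  is_deriv_meas U v P Q -> Cc1 U phi ->
  \int[mu]_(x in U) (v i x * derive1 phi x) = - sint (P i) (Q i) phi.
Proof.
move=> dv cphi; rewrite /Rintegral (dv i phi cphi).
have [bphi _] := Cc1_bmf cphi.
rewrite fineN fineB//; apply: integrable_fin_num => //; exact: bmf_integrable.
Qed.

Lemma Rint_sub_Cc1 (O U : set R) (v : R -> R) phi :
  U `<=` O -> Cc1 U phi ->
  \int[mu]_(x in O) (v x * derive1 phi x) = \int[mu]_(x in U) (v x * derive1 phi x).
Proof.
move=> UO cphi; have [K [_ KU K0]] := Cc1_deriv_out cphi.
rewrite Rintegral_mkcond [RHS]Rintegral_mkcond; apply: eq_Rintegral => x _.
rewrite /patch; have [/set_mem Ux|nU] := boolP (x \in U).
  by rewrite mem_set//; exact: UO.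
case: ifP => // _; rewrite (K0 x _).2 ?mulr0// => /KU Ux.
by rewrite mem_set in nU.
Qed.

End derivative_measures.

Section dual_field.
Context {R : realType} {n : nat}.
Local Notation mu := (@lebesgue_measure R).
Variables (a b lam : R) (f u : 'I_n -> R -> R).
Local Notation I := `]a, b[%classic.
Hypotheses (lam0 : 0 < lam) (L2f : L2 I f) (umin : is_minimizer a b lam f u).

Let gI i : R -> R := (fun x => u i x - f i x) \_ I.

(** With u - f extended by 0 outside I, this z is defined on the whole line, vanishes to the right
    of I and has derivative (u - f) / lam in I. *)
Definition dual_field i y : R := - (lam^-1 * tail (gI i) y).
Local Notation z := dual_field.

Lemma uf_intI i : intI a b (fun x => u i x - f i x).
Proof. by apply: intIB; apply: sqI_int; apply: L2_sqI => //; exact: umin.1. Qed.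

Lemma gI_int i : mu.-integrable setT (EFin \o gI i).
Proof.
have /integrable_mkcond := uf_intI i.
move=> /(_ (measurable_I a b)); rewrite /gI restrict_EFin; exact.
Qed.

Lemma dual_field_continuous i : continuous (z i).
Proof.
move=> y; apply: cvgN; apply: cvgM; first exact: cvg_cst.
exact: tail_continuous (gI_int i) y.
Qed.

Lemma rint_gI i (D : R -> R) :
  \int[mu]_(x in I) ((u i x - f i x) * D x) = \int[mu]_x (gI i x * D x).
Proof.
rewrite Rintegral_mkcond; apply: eq_Rintegral => x _.
by rewrite /gI /patch; case: ifP => //; rewrite mul0r.
Qed.

Lemma rint_Cc1 (D : R -> R) phi : Cc1 I phi ->
  \int[mu]_(x in I) (D x * derive1 phi x) = \int[mu]_x (D x * derive1 phi x).
Proof.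
by move=> cphi; rewrite [RHS](@Rint_sub_Cc1 _ setT I).
Qed.

Lemma Cc1_deriv_int phi : Cc1 I phi -> mu.-integrable setT (EFin \o derive1 phi).
Proof.
move=> cphi; have [_ bd] := Cc1_bmf cphi.
have /integrable_mkcond := intI_bmf a b bd.
move=> /(_ (measurable_I a b)); rewrite restrict_EFin.
have [K [_ KI K0]] := Cc1_deriv_out cphi.
rewrite (_ : derive1 phi \_ I = derive1 phi)//; apply/funext => x.
rewrite /patch; case: ifPn => // xI; rewrite (K0 x _).2// => /KI Ix.
by rewrite mem_set in xI.
Qed.

Lemma intT_bmfMr (g h : R -> R) : mu.-integrable setT (EFin \o g) -> bmf h ->
  mu.-integrable setT (EFin \o (fun x => g x * h x)).
Proof.
move=> ig [mh [M hM]].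
apply: (@integrableMl _ _ _ mu setT measurableT (EFin \o g) h ig) => //.
exists M; split; first exact: num_real.
by move=> N MN x _; exact: le_trans (hM x) (ltW MN).
Qed.

Lemma tail_indic (g : R -> R) y :
  \int[mu]_x (g x * \1_(`[y, +oo[%classic) x) = tail g y.
Proof.
rewrite /tail [RHS]Rintegral_mkcond; apply: eq_Rintegral => x _.
by rewrite patch_indic.
Qed.

(** Subtracting a jump of vector [e] at [y] raises the total variation by at most |e|. For [e] the
    tail of u - f at [y], the first-order term is |e|^2, so |e|^2 <= lam |e|; and z(y) = - e /
    lam. *)
Lemma dual_field_le1 y : \sum_i z i y ^+ 2 <= 1.
Proof.
have [V TVu] := minimizer_TV L2f umin.
pose e i := tail (gI i) y.
pose D i x : R := e i * \1_(`[y, +oo[%classic) x.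
have bD i : bmf (D i) by apply: bmfZ; apply: bmf_indic; exact: measurable_itv.
have := @minimizer_variation _ a b n lam f u lam0 L2f umin V (enorm e) D TVu bD.
have dV phi : testfun I phi -> dpair a b u phi <= V.
  move=> tphi; rewrite -lee_fin -TVu TVE.
    by apply: ereal_sup_ubound; exists phi.
  by move=> i; apply: sqI_int; apply: L2_sqI; exact: umin.1.
have -> : \sum_i \int[mu]_(x in I) ((u i x - f i x) * D i x) = \sum_i e i ^+ 2.
  apply: eq_bigr => i _; rewrite rint_gI.
  under eq_Rintegral do rewrite /D mulrCA.
  rewrite RintegralZl//.
    by rewrite tail_indic expr2.
  by apply: (intT_bmfMr (gI_int i)); apply: bmf_indic; exact: measurable_itv.
move=> h.
have /h : forall phi, testfun I phi -> dpair a b u phi - dpair a b D phi <= V + enorm e.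
  move=> phi tphi; have [cphi phi1] := tphi.
  have -> : dpair a b D phi = - \sum_i e i * phi i y.
    rewrite /dpair -sumrN; apply: eq_bigr => i _.
    rewrite rint_Cc1//.
    under eq_Rintegral do rewrite /D -mulrA [\1_ _ _ * _]mulrC.
    rewrite RintegralZl//.
      by rewrite tail_indic (tail_Cc1 y (cphi i)) mulrN.
    apply: (intT_bmfMr (Cc1_deriv_int (cphi i))).
    by apply: bmf_indic; exact: measurable_itv.
  rewrite opprK; apply: lerD; first exact: dV.
  under eq_bigr do rewrite mulrC.
  apply: dot_le_enorm; rewrite -enorm_le1; exact: phi1.
rewrite -enorm_sqr => el.
have : enorm e <= lam.
  have := enorm_ge0 e; rewrite le_eqVlt => /predU1P[<-|e0]; first exact: ltW.
  by move: el; rewrite expr2 mulrC ler_pM2r// .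
have -> : \sum_i z i y ^+ 2 = lam^-1 ^+ 2 * enorm e ^+ 2.
  rewrite enorm_sqr mulr_sumr; apply: eq_bigr => i _.
  by rewrite /z sqrrN exprMn.
move=> el'; rewrite -exprMn expr_le1// ?mulr_ge0 ?invr_ge0 ?enorm_ge0 ?(ltW lam0)//.
by rewrite ler_pdivrMl// mulr1.
Qed.

Lemma dual_field_bmf i : bmf (z i).
Proof.
apply: (@bmf_continuous _ _ 1); first exact: dual_field_continuous.
move=> y; have := dual_field_le1 y; rewrite -enorm_le1.
by apply: le_trans; exact: (abs_coord_le_enorm (fun i => z i y)).
Qed.

Variables (c d : R) (pu qu : 'I_n -> {finite_measure set R -> \bar R}).
Hypotheses (ac : a <= c) (db : d <= b).
Hypothesis du : is_deriv_meas `]c, d[%classic u pu qu.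

Lemma itv_sub_I s t : c <= s -> t <= d -> `]s, t[%classic `<=` (I : set R).
Proof.
move=> cs td x /=; rewrite !in_itv/= => /andP[sx xt].
by rewrite (le_lt_trans (le_trans ac cs) sx) (lt_le_trans xt (le_trans td db)).
Qed.

(* competitor: remove from u the part of its derivative carried by ]s, t[ *)
Lemma dual_field_calibrates_oo s t (e : 'I_n -> R) : c <= s -> t <= d ->
  \sum_i e i ^+ 2 <= 1 ->
  \sum_i e i * vmeas pu qu `]s, t[%classic i <= vint pu qu (restr z `]s, t[%classic).
Proof.
move=> cs td e1; pose J := `]s, t[%classic : set R.
have mJ : measurable J by exact: measurable_itv.
have JU : J `<=` `]c, d[%classic.
  move=> x; rewrite /J/= !in_itv/= => /andP[sx xt].
  by rewrite (le_lt_trans cs sx) (lt_le_trans xt td).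
have [V TVu] := minimizer_TV L2f umin.
have iu i : intI a b (u i) by apply: sqI_int; apply: L2_sqI; exact: umin.1.
have dV phi : testfun I phi -> dpair a b u phi <= V.
  by move=> tphi; rewrite -lee_fin -TVu TVE//; apply: ereal_sup_ubound; exists phi.
(* A primitive of the part of u' carried by [J]. *)
pose D i x : R := cdf_on (pu i) J x - cdf_on (qu i) J x.
have bD i : bmf (D i) by apply: bmfB; exact: cdf_on_bmf.
have byparts i (g : R -> R) : mu.-integrable setT (EFin \o g) ->
    \int[mu]_x (g x * D i x) = sint (pu i) (qu i) (fun y => tail g y * \1_J y).
  move=> ig; rewrite /sint -!(Rint_cdf_on _ mJ ig) -RintegralB//.
  - by congr Rintegral; apply/funext => x; rewrite /D; ring.
  - under [X in integrable _ _ X]eq_fun do rewrite /= mulrC.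
    by apply: (intT_bmfMr ig); exact: cdf_on_bmf.
  - under [X in integrable _ _ X]eq_fun do rewrite /= mulrC.
    by apply: (intT_bmfMr ig); exact: cdf_on_bmf.
(* The claim to verify is that removing this part lowers the total variation by at least e . u'(J).
   By parts, the first-order term is - lam int_J z . u', and the wanted inequality results. *)
have := @minimizer_variation _ a b n lam f u lam0 L2f umin V
  (- \sum_i e i * vmeas pu qu J i) D TVu bD.
have -> : \sum_i \int[mu]_(x in I) ((u i x - f i x) * D i x) =
    - (lam * vint pu qu (restr z J)).
  rewrite /vint mulr_sumr -sumrN; apply: eq_bigr => i _.
  rewrite rint_gI byparts; last exact: gI_int.
  have bz : bmf (restr z J i) by apply: bmf_restr => // j; exact: dual_field_bmf.
  rewrite -sintZ// -mulN1r -sintZ; last exact: bmfZ.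
  congr sint; apply/funext => x; rewrite /restr /z.
  by field; rewrite gt_eqF.
rewrite mulrN lerN2 ler_pM2l//; apply.
move=> phi tphi; have [cphi phi1] := tphi.
have bphi i : bmf (phi i) by have [] := Cc1_bmf (cphi i).
have -> : dpair a b D phi = - vint pu qu (restr phi J).
  rewrite /dpair /vint -sumrN; apply: eq_bigr => i _.
  rewrite rint_Cc1//.
  under eq_Rintegral do rewrite mulrC.
  rewrite byparts; last exact: Cc1_deriv_int.
  have bp : bmf (restr phi J i) by apply: bmf_restr.
  rewrite -mulN1r -sintZ//; congr sint; apply/funext => x.
  by rewrite (tail_Cc1 x (cphi i)) /restr mulN1r mulNr.
rewrite opprK.
pose w i x : R := phi i x + e i.
have bw i : bmf (w i) by apply: bmfD => //; exact: bmf_cst.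
have wE : vint pu qu (restr w J) =
    vint pu qu (restr phi J) + \sum_i e i * vmeas pu qu J i.
  rewrite -vint_cst// -vintD; [|exact: bmf_restr|]; last first.
    by apply: bmf_restr => // i; exact: bmf_cst.
  by congr vint; apply/funext => i; apply/funext => x; rewrite /restr /w/= mulrDl.
rewrite lerBrDr -addrA -wE.
pose chi := cutoff s t.
have cv : vint pu qu (fun i x => w i x * chi k x) @[k --> \oo] --> vint pu qu (restr w J).
  apply: cvg_big => [|i _]; first exact: add_continuous.
  have [mw [M wM]] := bw i.
  apply: (@sint_cvg _ _ _ _ _ M).
  - move=> k; apply: measurable_funM => //.
    by have [[]] := Cc1_bmf (Cc1_cutoff s t k).
  - move=> k x; rewrite normrM; apply: le_trans (wM x).
    have /andP[h0 h1] := cutoff_bounds s t k x.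
    by rewrite ler_piMr// ger0_norm.
  - by move=> x; apply: cvgM; [exact: cvg_cst|exact: cutoff_cvg].
have : dpair a b u phi + vint pu qu (fun i x => w i x * chi k x) @[k --> \oo] -->
    dpair a b u phi + vint pu qu (restr w J).
  by apply: cvgD => //; exact: cvg_cst.
move/cvgr_to_le; apply; apply: nearW => k.
(* This is (1 - chi) phi + chi (- e): inside [J] the test field is traded for the constant - e, and
   convexity of the unit ball keeps it admissible. Pairing it with u gives the bound [V] before the
   passage to the limit in [k]. *)
pose eta i x : R := phi i x - w i x * chi k x.
have cw i : Cc1 J (fun x => w i x * chi k x).
  apply: Cc1M; last exact: Cc1_cutoff.
  by have [] := C1D (Cc1_C1 (cphi i)) (C1_cst (e i)).1.
have cnw i : Cc1 J (fun x => cst (-1) x * (w i x * chi k x)).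
  by apply: Cc1M => //; have [] := C1_cst (-1 : R).
have JI : J `<=` I by apply: (subset_trans JU); exact: itv_sub_I.
have etaE i : eta i = (fun x => phi i x + cst (-1) x * (w i x * chi k x)).
  by apply/funext => x; rewrite /eta /= mulN1r.
have teta : testfun I eta.
  split=> [i|x].
    by rewrite etaE; apply: Cc1D => //; apply: Cc1_subset (cnw i).
  rewrite enorm_le1.
  have /andP[h0 h1] := cutoff_bounds s t k x.
  have p1 := phi1 x; rewrite enorm_le1 in p1.
  apply: (@le_trans _ _ ((1 - chi k x) * (\sum_i phi i x ^+ 2) +
      chi k x * (\sum_i e i ^+ 2))).
    rewrite !mulr_sumr -big_split; apply: ler_sum => i _ /=.
    rewrite /eta /w -/(chi k x) in h0 h1 *.
    rewrite -subr_ge0.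
    (* The exact defect in the convexity of the square. *)
    rewrite (_ : _ - _ = chi k x * (1 - chi k x) * (phi i x + e i) ^+ 2); last by ring.
    by rewrite mulr_ge0 ?sqr_ge0// mulr_ge0// subr_ge0.
  by rewrite -/(chi k x) in h0 h1 *; nra.
apply: le_trans (dV _ teta).
rewrite /dpair /vint -big_split; apply: ler_sum => i _ /=.
have [_ dE] := C1D (Cc1_C1 (cphi i)) (Cc1_C1 (cnw i)).
have [_ dE2] := C1M (C1_cst (-1 : R)).1 (Cc1_C1 (cw i)).
have dE1 : derive1 (eta i) = (fun x =>
    derive1 (phi i) x - derive1 (fun x => w i x * chi k x) x).
  rewrite etaE dE dE2; apply/funext => x; rewrite (C1_cst (-1 : R)).2/=; ring.
have bdphi : bmf (derive1 (phi i)) by have [] := Cc1_bmf (cphi i).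
have bdw : bmf (derive1 (fun x => w i x * chi k x)) by have [] := Cc1_bmf (cw i).
have -> : \int[mu]_(x in I) (u i x * derive1 (eta i) x) =
   \int[mu]_(x in I) (u i x * derive1 (phi i) x) -
   \int[mu]_(x in I) (u i x * derive1 (fun x => w i x * chi k x) x).
  rewrite -rintB; [|exact: intI_bmfMr..].
  by congr Rintegral; apply/funext => x; rewrite dE1 mulrBr.
rewrite lerD2l (@Rint_sub_Cc1 _ I `]c, d[%classic).
- by rewrite (deriv_measE i du) ?opprK//; exact: Cc1_subset (cw i).
- exact: itv_sub_I.
- exact: Cc1_subset (cw i).
Qed.

(** For fixed [e] the difference of the two sides is the signed measure (z - e) . u', known to be
    nonnegative on open intervals. *)
Lemma dual_field_calibrates B (e : 'I_n -> R) : measurable B ->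
  B `<=` `]c, d[%classic -> \sum_i e i ^+ 2 <= 1 ->
  \sum_i e i * vmeas pu qu B i <= vint pu qu (restr z B).
Proof.
move=> mB BU e1.
pose w i x : R := z i x - e i.
have bw i : bmf (w i) by apply: bmfB; [exact: dual_field_bmf|exact: bmf_cst].
have wE A : measurable A -> vint pu qu (restr z A) =
    vint pu qu (restr w A) + \sum_i e i * vmeas pu qu A i.
  move=> mA; rewrite -vint_cst// -vintD; [|exact: bmf_restr|]; last first.
    by apply: bmf_restr => // i; exact: bmf_cst.
  by congr vint; apply/funext => i; apply/funext => x; rewrite /restr /w/=; ring.
rewrite wE// lerDr.
apply: (smeas_nonneg_oo (vint_smeas pu qu bw) _ mB BU) => s t cs td.
have := dual_field_calibrates_oo cs td e1.
by rewrite wE ?lerDr//; exact: measurable_itv.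
Qed.

End dual_field.

(** * Concavity on the contact set *)

Section contact_set.
Context {R : realType} {n : nat}.
Variables (z : 'I_n -> R -> R) (kappa c d : R).
Variables (P Q : 'I_n -> {finite_measure set R -> \bar R}).
Hypotheses (kappa0 : 0 < kappa).
Hypotheses (cz : forall i, continuous (z i)) (z1 : forall x, \sum_i z i x ^+ 2 <= 1).

Definition slope i x y : R := (z i y - z i x) / (y - x).

(* weak form of z'' = kappa (P - Q) *)
Hypothesis slopeE : forall i x1 x2 y1 y2, c < x1 -> x1 < x2 -> x2 <= y1 ->
  y1 < y2 -> y2 < d ->
  slope i x1 x2 - slope i y1 y2 = - kappa * sint (P i) (Q i) (hat x1 x2 y1 y2).

Definition contact : set R := [set x | \sum_i z i x ^+ 2 = 1].
Local Notation E := contact.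
Local Notation N := (vnint P Q).

Let bz i : bmf (z i).
Proof.
apply: (@bmf_continuous _ _ 1); first exact: cz.
move=> y; have := z1 y; rewrite -enorm_le1.
by apply: le_trans; exact: (abs_coord_le_enorm (fun i => z i y)).
Qed.

Lemma closed_contact : closed E.
Proof.
have c2 : continuous (fun x => \sum_i z i x ^+ 2).
  move=> x; apply: cvg_big => [|i _]; first exact: add_continuous.
  rewrite (_ : (fun x => z i x ^+ 2) = (fun x => z i x * z i x)); last first.
    by apply/funext => y; rewrite expr2.
  by rewrite expr2; apply: cvgM; exact: cz.
rewrite (_ : E = (fun x => \sum_i z i x ^+ 2) @^-1` [set 1]); last by [].
by apply: preimage_closed; [move=> x _; exact: c2|exact: closed_eq].
Qed.

Let mE : measurable E.
Proof. exact: closed_measurable closed_contact. Qed.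

Lemma bmf_hat (x1 x2 y1 y2 : R) : x1 < x2 -> x2 <= y1 -> y1 < y2 ->
  bmf (hat x1 x2 y1 y2).
Proof.
move=> x12 xy y12; apply: (@bmf_continuous _ _ 1).
  have cp r : continuous (fun x : R => pos (x - r)).
    move=> x; apply: (@continuous_comp _ _ _ (fun x => x - r) (Num.max 0)); last first.
      by rewrite -(@C1_sqpos R).2; exact: (@C1_sqpos R).1.2.
    by apply: cvgB; [exact: cvg_id|exact: cvg_cst].
  move=> x; apply: cvgB; apply: cvgM; try exact: cvg_cst;
    by apply: cvgB; exact: cp.
by move=> x; have /andP[h0 h1] := hat_bounds x12 xy y12 x; rewrite ger0_norm.
Qed.

Lemma sum_sqr_le (m : 'I_n -> R) S : \sum_i `|m i| <= S -> \sum_i m i ^+ 2 <= S ^+ 2.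
Proof.
move=> mS.
have S0 : 0 <= S by apply: le_trans mS; apply: sumr_ge0.
apply: (@le_trans _ _ (\sum_i `|m i| * S)); last first.
  by rewrite -mulr_suml expr2 ler_wpM2r.
apply: ler_sum => i _; rewrite -real_normK ?num_real// expr2 ler_wpM2l//.
apply: le_trans mS; rewrite (bigD1 i)//= lerDl; exact: sumr_ge0.
Qed.

Lemma sum_sint_le g : bmf g -> (forall x, 0 <= g x) ->
  \sum_i `|sint (P i) (Q i) g| <= N g.
Proof.
move=> bg g0; apply: ler_sum => i _; apply: le_trans (sint_norm_le _ _ bg) _.
apply: nint_le => // [|x]; first exact: bmf_norm.
by rewrite ger0_norm.
Qed.

(* The boundary terms have a sign because |z| is maximal at s and t.  The interior
   term is - (t - s) a . b <= (t - s) |a - b|^2 / 4, where a and b are the slopes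
   of z on [s, t] and on [t, t + h], and |a - b| is at most kappa times the mass of
   P + Q near [s, t]. *)
Lemma contact_pair_hat s t h : E s -> E t -> s <= t -> 0 < h ->
  c < s - h -> t + h < d ->
  \sum_i z i s * sint (P i) (Q i) (hat (s - h) s t (t + h)) <=
  kappa / 4 * (t - s) * N (hat (s - h) s t (t + h)) ^+ 2.
Proof.
move=> Es Et st h0 csh thd.
have sh : s - h < s by lra.
have th : t < t + h by lra.
pose T := hat (s - h) s t (t + h).
have bT : bmf T by exact: bmf_hat.
pose Dl i := z i (t + h) - z i t.
have sE i : sint (P i) (Q i) T =
    (kappa * h)^-1 * (Dl i - (z i s - z i (s - h))).
  have := slopeE i csh sh st th thd.
  rewrite /slope (_ : s - (s - h) = h); last by ring.
  rewrite (_ : t + h - t = h); last by ring.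
  rewrite -/T -/(Dl i) => e.
  apply: (@mulfI _ (- kappa)); first by rewrite oppr_eq0 gt_eqF.
  by rewrite -e; field; rewrite !gt_eqF.
have kh : 0 < (kappa * h)^-1 by rewrite invr_gt0 mulr_gt0.
have s2 : 0 <= \sum_i z i s * (z i s - z i (s - h)).
  under eq_bigr do rewrite mulrBr -expr2.
  by rewrite sumrB Es subr_ge0 dot_le1// Es.
have t2 : \sum_i z i t * Dl i <= 0.
  under eq_bigr do rewrite mulrBr -expr2.
  by rewrite sumrB Et subr_le0 dot_le1// Et.
have -> : \sum_i z i s * sint (P i) (Q i) T = (kappa * h)^-1 *
   (\sum_i z i t * Dl i - \sum_i (z i t - z i s) * Dl i
    - \sum_i z i s * (z i s - z i (s - h))).
  rewrite -!sumrB mulr_sumr; apply: eq_bigr => i _; rewrite sE; ring.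
apply: (@le_trans _ _ ((kappa * h)^-1 * (- \sum_i (z i t - z i s) * Dl i))).
  by rewrite ler_pM2l//; lra.
(* For s = t there is no slope over [s, t], but the interior term vanishes. *)
move: st; rewrite le_eqVlt => /predU1P[st|st].
  rewrite st subrr mulr0 mul0r big1 ?oppr0 ?mulr0// => i _.
  by rewrite subrr mul0r.
(* This hat compares the slopes over [s, t] and [t, t + h]; it lies below [T], so its mass is
   controlled by that of [T]. *)
pose T' := hat s t t (t + h).
have bT' : bmf T' by exact: bmf_hat.
have T'0 x : 0 <= T' x by have /andP[] := hat_bounds st (lexx t) th x.
have TT' x : T' x <= T x.
  have [xs|sx] := leP x s.
    by rewrite /T' hat_eq0l//; have /andP[] := hat_bounds sh (ltW st) th x.
  have [xt|tx] := leP x t.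
    by rewrite /T (hat_eq1 sh th (ltW sx))//; have /andP[] := hat_bounds st (lexx t) th x.
  rewrite /T /T' /hat (ramp_eq1 st (ltW tx)) (ramp_eq1 sh)//.
  exact: ltW.
have Lh : - \sum_i (z i t - z i s) * Dl i <=
    (t - s) * h / 4 * (kappa ^+ 2 * N T ^+ 2).
  have ts0 : 0 < t - s by rewrite subr_gt0.
  have st' : c < s by lra.
  have dE i : (z i t - z i s) / (t - s) - Dl i / h = - kappa * sint (P i) (Q i) T'.
    have := slopeE i st' st (lexx t) th thd.
    by rewrite /slope (_ : t + h - t = h); last by ring.
  have : \sum_i (kappa * sint (P i) (Q i) T') ^+ 2 <= kappa ^+ 2 * N T ^+ 2.
    rewrite -exprMn; apply: sum_sqr_le.
    under eq_bigr do rewrite normrM gtr0_norm//.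
    rewrite -mulr_sumr ler_pM2l//; apply: le_trans (sum_sint_le bT' T'0) _.
    exact: vnint_le.
  move=> h1; apply: le_trans (_ : (t - s) * h / 4 *
     \sum_i (kappa * sint (P i) (Q i) T') ^+ 2 <= _); last first.
    by rewrite ler_wpM2l// divr_ge0// mulr_ge0// ltW.
  rewrite -sumrN mulr_sumr; apply: ler_sum => i _.
  have -> : (kappa * sint (P i) (Q i) T') ^+ 2 =
     ((z i t - z i s) / (t - s) - Dl i / h) ^+ 2.
    by rewrite dE mulNr sqrrN.
  (* The identity (a - b)^2 + 4 a b = (a + b)^2, which is where the constant 1/4 comes from. *)
  rewrite -subr_ge0.
  have -> : (t - s) * h / 4 * ((z i t - z i s) / (t - s) - Dl i / h) ^+ 2 -
     - ((z i t - z i s) * Dl i) =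
     (t - s) * h / 4 * ((z i t - z i s) / (t - s) + Dl i / h) ^+ 2.
    by field; rewrite !gt_eqF.
  by rewrite mulr_ge0 ?sqr_ge0// divr_ge0// mulr_ge0// ltW.
apply: le_trans (_ : (kappa * h)^-1 * ((t - s) * h / 4 * (kappa ^+ 2 * N T ^+ 2)) <= _).
  by rewrite ler_pM2l.
rewrite -/T le_eqVlt; apply/orP; left; apply/eqP.
by field; rewrite !gt_eqF.
Qed.

(** The hats equal 1 on [s, t] and shrink to its indicator as h tends to 0. The interval is closed,
    so atoms at the two contact points are included. *)
Lemma contact_pair s t : E s -> E t -> s <= t -> c < s -> t < d ->
  \sum_i z i s * vmeas P Q `[s, t]%classic i <=
  kappa / 4 * (t - s) * N \1_(`[s, t]%classic) ^+ 2.
Proof.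
move=> Es Et st cs td.
have mst : measurable (`[s, t]%classic : set R) by exact: measurable_itv.
have [h0 [h00 ch dh]] : exists h0, [/\ 0 < h0, c < s - h0 & t + h0 < d].
  exists (Num.min ((s - c) / 2) ((d - t) / 2)); split.
  - by rewrite lt_min; apply/andP; split; lra.
  - have : Num.min ((s - c) / 2) ((d - t) / 2) <= (s - c) / 2 by rewrite ge_min lexx.
    lra.
  - have : Num.min ((s - c) / 2) ((d - t) / 2) <= (d - t) / 2 by rewrite ge_min lexx orbT.
    lra.
pose h k := h0 * harmonic k.
have hk k : 0 < h k by rewrite mulr_gt0// harmonic_gt0.
have hk0 k : h k <= h0.
  by rewrite /h ler_piMr ?(ltW h00)// /harmonic/= invf_le1 ?ltr0n// ler1n.
pose T k := hat (s - h k) s t (t + h k).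
have bT k : bmf (T k) by apply: bmf_hat => //; [rewrite gtrBl|rewrite ltrDl].
have T01 k x : 0 <= T k x <= 1 by apply: hat_bounds => //; [rewrite gtrBl|rewrite ltrDl].
have cT x : T k x @[k --> \oo] --> (\1_(`[s, t]%classic) x : R).
  have sm r : 0 < r -> exists K, forall k, (K <= k)%N -> h k < r.
    move=> r0; have [K hK] := @harmonic_lt _ (r / h0) (divr_gt0 r0 h00).
    by exists K => k /hK; rewrite ltr_pdivlMr// mulrC.
  rewrite indicE mem_setE in_itv/=.
  have [sx|xs] := leP s x; last first.
    have [K hK] := sm (s - x) ltac:(by rewrite subr_gt0).
    apply: (@cvg_eventually_eq _ _ _ K) => k /hK hs.
    apply: hat_eq0l; [by rewrite gtrBl|by []|by rewrite ltrDl|].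
    by rewrite lerBrDr -lerBrDl ltW.
  have [xt|tx] := leP x t; last first.
    have [K hK] := sm (x - t) ltac:(by rewrite subr_gt0).
    apply: (@cvg_eventually_eq _ _ _ K) => k /hK hs.
    apply: hat_eq0r; [by rewrite gtrBl|by []|by rewrite ltrDl|].
    by rewrite -lerBrDl ltW.
  apply: (@cvg_eventually_eq _ _ _ 0%N) => k _.
  by apply: hat_eq1 => //; [rewrite gtrBl|rewrite ltrDl].
have Tn k x : `|T k x| <= 1 by have /andP[t0 t1] := T01 k x; rewrite ger0_norm.
have c1 : \sum_i z i s * sint (P i) (Q i) (T k) @[k --> \oo] -->
    \sum_i z i s * vmeas P Q `[s, t]%classic i.
  apply: cvg_big => [|i _]; first exact: add_continuous.
  apply: cvgM; first exact: cvg_cst.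
  rewrite /vmeas -!Rint_indic//.
  by apply: (@sint_cvg _ _ _ _ _ 1) => // k; have [] := bT k.
have c2 : kappa / 4 * (t - s) * N (T k) ^+ 2 @[k --> \oo] -->
    kappa / 4 * (t - s) * N \1_(`[s, t]%classic) ^+ 2.
  apply: cvgM; first exact: cvg_cst.
  have cN : N (T k) @[k --> \oo] --> N \1_(`[s, t]%classic).
    apply: cvg_big => [|i _]; first exact: add_continuous.
    by apply: (@nint_cvg _ _ _ _ _ 1) => // k; have [] := bT k.
  under eq_fun do rewrite expr2.
  by rewrite expr2; exact: cvgM.
apply: (ler_cvg_to c1 c2); apply: nearW => k.
apply: contact_pair_hat => //.
  by apply: lt_le_trans ch _; rewrite lerD2l lerN2.
by apply: le_lt_trans dh; rewrite lerD2l.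
Qed.

(** Every slope inside [s0, t0] differs from the slope over one fixed interval to its right by at
    most [kappa] times the total mass. *)
Lemma locally_lipschitz s0 t0 : c < s0 -> t0 < d -> exists La : R, 0 <= La /\
  forall i x y, s0 <= x -> x <= y -> y <= t0 -> `|z i y - z i x| <= La * (y - x).
Proof.
move=> cs td.
pose t1 := (t0 + d) / 2.
have [t01 t1d] : t0 < t1 /\ t1 < d by rewrite /t1; split; lra.
exists (\sum_i `|slope i t0 t1| + kappa * N \1_setT); split.
  by rewrite addr_ge0 ?sumr_ge0// mulr_ge0 ?(ltW kappa0) ?vnint_ge0.
move=> i x y sx; rewrite le_eqVlt => /predU1P[<- _|xy yt].
  by rewrite !subrr mulr0 normr0.
have cx := lt_le_trans cs sx.
have yx : 0 < y - x by rewrite subr_gt0.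
rewrite -ler_pdivrMr// -[X in _ / X]gtr0_norm// -normf_div -/(slope i x y).
have e := slopeE i cx xy yt t01 t1d.
have -> : slope i x y = slope i t0 t1 - kappa * sint (P i) (Q i) (hat x y t0 t1).
  by rewrite -mulNr -e; ring.
apply: le_trans (ler_normB _ _) _; apply: lerD.
  rewrite (bigD1 i)//= lerDl; exact: sumr_ge0.
rewrite normrM gtr0_norm// ler_pM2l//.
have bh := bmf_hat xy yt t01.
have h0 w : 0 <= hat x y t0 t1 w by have /andP[] := hat_bounds xy yt t01 w.
apply: (@le_trans _ _ (\sum_j `|sint (P j) (Q j) (hat x y t0 t1)|)).
  by rewrite (bigD1 i)//= lerDl; exact: sumr_ge0.
apply: le_trans (sum_sint_le bh h0) _; apply: vnint_le => //.
  exact: bmf_indic.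
by move=> w; rewrite indicT; have /andP[] := hat_bounds xy yt t01 w.
Qed.

(* The hull of E in a cell of length < h exceeds E inside near_contact h, whose
   measure vanishes as h tends to 0. *)
Definition near_contact h : set R := (\bigcup_(y in E) ball y h) `\` E.

Lemma measurable_near_contact h : measurable (near_contact h).
Proof.
apply: measurableD; last exact: mE.
by apply: open_measurable; apply: bigcup_open => y _; exact: ball_open.
Qed.

(** Shrink the cell to the hull of its contact points. There z is close to its value at the left
    end, where [contact_pair] applies; the non-contact part of the hull lies in [near_contact h],
    and |z| <= 1 bounds its contribution by its mass. *)
Lemma vint_contact_cell s0 t0 La s t h : c < s0 -> t0 < d -> 0 <= La ->
  (forall i x y, s0 <= x -> x <= y -> y <= t0 -> `|z i y - z i x| <= La * (y - x)) ->
  s0 <= s -> s <= t -> t <= t0 -> t - s < h ->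
  vint P Q (restr z (`[s, t]%classic `&` E)) <=
  (kappa / 4 * N \1_setT + La) * (t - s) * N \1_(`[s, t]%classic) +
  N \1_(`[s, t]%classic `&` near_contact h).
Proof.
move=> cs td La0 lip s0s st tt0 tsh.
have mst x y : measurable (`[x, y]%classic : set R) by exact: measurable_itv.
have N0 A : 0 <= N \1_A by exact: vnint_ge0.
have [->|/set0P E0] := eqVneq (`[s, t]%classic `&` E) set0.
  rewrite (smeas0 (vint_smeas P Q bz)) addr_ge0// mulr_ge0//.
  by rewrite mulr_ge0 ?subr_ge0// addr_ge0// mulr_ge0// divr_ge0// ltW.
have cptE : compact (`[s, t]%classic `&` E).
  by apply: compact_closedI; [exact: segment_compact|exact: closed_contact].
have cid : {within `[s, t]%classic `&` E, continuous (@idfun R)}.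
  by apply: continuous_subspaceT => x; exact: cvg_id.
(* The extreme contact points of the cell, which exist by compactness. *)
have [s' /set_mem[+ Es'] s'min] := compact_EVT_min E0 cptE cid.
have [t' /set_mem[+ Et'] t'max] := compact_EVT_max E0 cptE cid.
rewrite /= !in_itv/= => /andP[st' t't] /andP[ss' s't].
have s't' : s' <= t'.
  by apply: t'max; apply/mem_set; split=> //=; rewrite in_itv/= ss' s't.
pose J := `[s', t']%classic : set R.
have JS : J `<=` `[s, t]%classic.
  move=> x; rewrite /J/= !in_itv/= => /andP[h1 h2].
  by rewrite (le_trans ss' h1) (le_trans h2 t't).
have EJ : `[s, t]%classic `&` E = J `&` E.
  apply/seteqP; split=> x [xst Ex]; split=> //; last exact: JS.
  by rewrite /J/= in_itv/= s'min ?t'max//; apply/mem_set.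
rewrite EJ.
have sm := vint_smeas P Q bz.
have mJ : measurable J by exact: mst.
have mJE : measurable (J `&` E) by exact: measurableI mJ mE.
have mJD : measurable (J `\` E) by exact: measurableD mJ mE.
have split_J : vint P Q (restr z J) =
    vint P Q (restr z (J `&` E)) + vint P Q (restr z (J `\` E)).
  rewrite -sm.1//; last by rewrite -subset0 => x [[_ Ex] [_]].
  by rewrite setUIDK.
have hD : - N \1_(`[s, t]%classic `&` near_contact h) <= vint P Q (restr z (J `\` E)).
  have : `|vint P Q (restr z (J `\` E))| <= N \1_(J `\` E).
    apply: vint_norm_le; [exact: bmf_restr|exact: bmf_indic|].
    move=> i x; rewrite /restr normrM [X in _ * X]ger0_norm; last by rewrite indicE.
    apply: ler_piMl; first by rewrite indicE.
    apply: le_trans (abs_coord_le_enorm (fun i => z i x) i) _.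
    by rewrite enorm_le1.
  have : N \1_(J `\` E) <= N \1_(`[s, t]%classic `&` near_contact h).
    apply: vnint_indic_le => //.
      by apply: measurableI => //; exact: measurable_near_contact.
    move=> x [Jx nE]; split; first exact: JS.
    split=> //; exists s' => //.
    move: Jx; rewrite /J/= in_itv/= => /andP[s'x xt'].
    rewrite /ball/= ler0_norm ?subr_le0// opprB.
    by apply: le_lt_trans tsh; apply: lerB => //; exact: le_trans t't.
  by rewrite ler_norml => h1 /andP[h2 _]; lra.
have hJ : vint P Q (restr z J) <=
    (kappa / 4 * N \1_setT + La) * (t - s) * N \1_(`[s, t]%classic).
  have cs' : c < s' by apply: lt_le_trans ss'; apply: lt_le_trans s0s.
  have t'd : t' < d by apply: le_lt_trans t't _; apply: le_lt_trans td.
  have h1 := contact_pair Es' Et' s't' cs' t'd.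
  have wr i x : J x -> `|z i x - z i s'| <= La * (t' - s').
    rewrite /J/= in_itv/= => /andP[s'x xt'].
    apply: le_trans (lip i s' x _ s'x _) _.
    - exact: le_trans s0s ss'.
    - by apply: le_trans xt' _; exact: le_trans t't tt0.
    - by rewrite ler_wpM2l// lerD2r.
  have := vint_restr_cst_le P Q bz (mst s' t') wr.
  rewrite ler_norml => /andP[_ h2].
  have NJ : N \1_J <= N \1_(`[s, t]%classic) by exact: vnint_indic_le.
  have NT : N \1_J <= N \1_setT by exact: vnint_indic_le.
  have L1 : 0 <= t' - s' by rewrite subr_ge0.
  have L2 : t' - s' <= t - s by exact: lerB.
  have NJ0 := N0 J.
  have k4 : 0 <= kappa / 4 by rewrite divr_ge0// ltW.
  have h3 : kappa / 4 * (t' - s') * N \1_J ^+ 2 <=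
      kappa / 4 * N \1_setT * (t - s) * N \1_(`[s, t]%classic).
    rewrite expr2 mulrA; apply: ler_pM => //.
      by rewrite mulr_ge0// mulr_ge0.
    rewrite -[X in _ <= X]mulrA [X in _ <= _ * X]mulrC mulrA.
    by apply: ler_pM => //; [rewrite mulr_ge0|rewrite ler_wpM2l].
  have h4 : La * (t' - s') * N \1_J <= La * (t - s) * N \1_(`[s, t]%classic).
    by apply: ler_pM => //; [rewrite mulr_ge0|rewrite ler_wpM2l].
  rewrite mulrDl mulrDl.
  move: h2; rewrite lerBlDr => h2.
  by move: h1 h2 h3 h4; rewrite -/J; lra.
by move: split_J hD hJ; lra.
Qed.

(** Cut into cells of length [l]. The first errors add up to C l times the total mass; the others
    are carried by [near_contact]. Both tend to 0 with [l]. *)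
Lemma vint_contact_ocitv s t : c < s -> s < t -> t < d ->
  vint P Q (restr z (`]s, t]%classic `&` E)) <= 0.
Proof.
move=> cs st td; have [La [La0 lip]] := locally_lipschitz cs td.
set C := kappa / 4 * N \1_setT + La.
have C0 : 0 <= C.
  by rewrite addr_ge0// mulr_ge0 ?vnint_ge0// divr_ge0// ltW.
(* The error bound minus the contact integral, arranged to be additive in [A], so that nonnegativity
   on cells can be summed. *)
pose W l h A := C * l * N \1_A + N \1_(A `&` near_contact h)
   - vint P Q (restr z (A `&` E)).
have smZ r m : smeas m -> smeas (fun A => r * m A) :> Prop.
  move=> [m1 m2]; split=> [A B mA mB AB|F A mF mA FA].
    by rewrite m1// mulrDr.
  by apply: cvgM; [exact: cvg_cst|exact: m2].
have smW l h : smeas (W l h).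
  apply: smeasD; last first.
    apply: smeasN; exact: (smeas_setI mE (vint_smeas P Q bz)).
  apply: smeasD; first by apply: smZ; exact: vnint_smeas.
  exact: (smeas_setI (measurable_near_contact h) (vnint_smeas P Q)).
have Wcc l h x y : s <= x -> x <= y -> y <= t -> y - x <= l -> l < h ->
    0 <= W l h `[x, y]%classic.
  move=> sx xy yt xyl lh.
  have := vint_contact_cell cs td La0 lip sx xy yt (le_lt_trans xyl lh).
  rewrite -/C /W subr_ge0 => /le_trans; apply; rewrite lerD2r.
  by rewrite ler_wpM2r ?vnint_ge0// ler_wpM2l.
(* Closed cells would count atoms at grid points twice; left-open cells are limits of closed ones
   and are disjoint. *)
have Woc l h x y : s <= x -> x < y -> y <= t -> y - x <= l -> l < h ->
    0 <= W l h `]x, y]%classic.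
  move=> sx xy yt xyl lh.
  have yx0 : 0 < y - x by rewrite subr_gt0.
  pose e k := (y - x) * k.+1%:R^-1.
  have e0 k : 0 < e k by rewrite mulr_gt0// invr_gt0.
  have e1 k : e k <= y - x.
    by rewrite /e ler_piMr ?(ltW yx0)// invf_le1 ?ltr0n// ler1n.
  apply: (@smeas_ge0_limit _ _ (fun k => `[x + e k, y]%classic) _ (smW l h)).
  - by move=> k; exact: measurable_itv.
  - exact: measurable_itv.
  - move=> w; have [xw|wx] := ltP x w; last first.
      exists 0%N => k _; rewrite /= !in_itv/= [x < w]ltNge wx/=; split=> //.
      by move=> /andP[h1 _]; have := le_trans h1 wx; rewrite gerDl leNgt e0.
    have [K hK] := @harmonic_lt _ ((w - x) / (y - x))
      ltac:(by rewrite divr_gt0 ?subr_gt0).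
    exists K => k /hK hk; rewrite /= !in_itv/= xw.
    have -> : x + e k <= w; last by [].
    by move: hk; rewrite ltr_pdivlMr// mulrC -/(e k) -lerBrDl => /ltW.
  - move=> k; apply: Wcc => //.
    + by apply: le_trans sx _; rewrite lerDl ltW.
    + by rewrite -lerBrDl.
    + by apply: le_trans xyl; rewrite lerD2l lerN2 lerDl ltW.
have ts0 : 0 < t - s by rewrite subr_gt0.
pose l k := (t - s) * k.+1%:R^-1.
have l0 k : 0 < l k by rewrite mulr_gt0// invr_gt0.
have kl k : k.+1%:R * l k = t - s.
  by rewrite /l mulrCA divff ?mulr1// pnatr_eq0.
(* The cell estimate requires a length strictly below [h], hence [2 * l k] for cells of length
   [l k]. *)
have Wgrid k : 0 <= W (l k) (2 * l k) `]s, t]%classic.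
  have smk := smW (l k) (2 * l k).
  suff h j : (j <= k.+1)%N -> 0 <= W (l k) (2 * l k) `]s, (s + j%:R * l k)]%classic.
    by have := h k.+1 (leqnn _); rewrite kl addrC subrK.
  elim: j => [_|j ih jk].
    by rewrite mul0r addr0 set_itv_ge ?bnd_simp ?ltxx// (smeas0 smk).
  have step : s + j.+1%:R * l k = (s + j%:R * l k) + l k.
    by rewrite -natr1; ring.
  rewrite (@itv_bndbnd_setU _ _ _ (BRight (s + j%:R * l k))); last 2 first.
  - by rewrite bnd_simp lerDl mulr_ge0// ltW.
  - by rewrite bnd_simp step lerDl ltW.
  rewrite smk.1; [|exact: measurable_itv|exact: measurable_itv|]; last first.
    rewrite -subset0 => w [/=]; rewrite !in_itv/= => /andP[_ h1] /andP[h2 _].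
    by move: h2; rewrite ltNge h1.
  apply: addr_ge0; first by apply: ih; exact: ltnW.
  apply: Woc.
  - by rewrite lerDl mulr_ge0// ltW.
  - by rewrite step ltrDl.
  - rewrite -[X in _ <= X](subrK s) [X in _ <= X]addrC lerD2l -(kl k).
    by rewrite ler_pM2r// ler_nat.
  - by rewrite step addrAC subrr add0r.
  - by have := l0 k; lra.
have cl : l k @[k --> \oo] --> 0.
  rewrite -(mulr0 (t - s)); apply: cvgM; [exact: cvg_cst|exact: cvg_harmonic].
pose A := `]s, t]%classic : set R.
have mA : measurable A by exact: measurable_itv.
(* Since the contact set is closed, a point outside it leaves [near_contact] once the radius is
   small; points of the set were excluded from the start. *)
have cV : N \1_(A `&` near_contact (2 * l k)) @[k --> \oo] --> N \1_set0.
  apply: (vnint_smeas P Q).2 => [k||w].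
  - by apply: measurableI => //; exact: measurable_near_contact.
  - exact: measurable0.
  - have [Ew|nE] := pselect (E w).
      by exists 0%N => k _; split=> // -[_ []].
    have oE : open (~` E) by apply: closed_openC; exact: closed_contact.
    have /nbhs_ballP[r /= r0 rE] := open_nbhs_nbhs (conj oE nE).
    have [K hK] := @harmonic_lt _ (r / (2 * (t - s)))
      ltac:(by rewrite divr_gt0// mulr_gt0).
    exists K => k /hK; rewrite ltr_pdivlMr ?mulr_gt0// => hk.
    split=> // -[_ [[y Ey yw] _]]; apply: (rE y) => //.
    apply: ball_sym; apply: le_ball yw.
    by move: hk; rewrite mulrC -mulrA -/(l k) => /ltW.
have cR : C * l k * N \1_A + N \1_(A `&` near_contact (2 * l k)) @[k --> \oo] -->
    C * 0 * N \1_A + N \1_set0.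
  apply: cvgD => //; apply: cvgM; last exact: cvg_cst.
  by apply: cvgM => //; exact: cvg_cst.
have N00 : N \1_set0 = 0 by rewrite (smeas0 (vnint_smeas P Q)).
move: cR; rewrite N00 mulr0 mul0r addr0 => /cvgr_to_ge; apply.
by apply: nearW => k; have := Wgrid k; rewrite /W subr_ge0.
Qed.

Lemma vint_contact_le0 B : measurable B -> B `<=` `]c, d[%classic ->
  vint P Q (restr z (B `&` E)) <= 0.
Proof.
move=> mB BU; rewrite -oppr_ge0.
have sm : smeas (fun A => - vint P Q (restr z (A `&` E))).
  by apply: smeasN; exact: (smeas_setI mE (vint_smeas P Q bz)).
apply: (smeas_nonneg_open sm _ mB BU) => s t cs.
rewrite le_eqVlt => /predU1P[->|st] td.
  by rewrite set_itv_ge ?bnd_simp ?ltxx// (smeas0 sm).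
by rewrite oppr_ge0; exact: vint_contact_ocitv.
Qed.

End contact_set.

(** * The second derivative of the dual field and the comparison of u' with f' *)

Section finite_measure_add.
Context {R : realType} (m1 m2 : {finite_measure set R -> \bar R}).

Let measure_add_fin_num : fin_num_fun (measure_add m1 m2).
Proof.
by move=> A mA; rewrite measure_addE fin_numD !fin_num_measure.
Qed.

Definition sum_measure : set R -> \bar R := measure_add m1 m2.

HB.instance Definition _ := Measure.copy sum_measure
  (msum (fun k => if k is 0%N then m1 : {measure set R -> \bar R} else m2) 2).
HB.instance Definition _ :=
  @Measure_isFinite.Build _ _ _ sum_measure measure_add_fin_num.

Definition finite_measure_add : {finite_measure set R -> \bar R} := sum_measure.

Lemma Rint_measure_add g : bmf g ->
  \int[finite_measure_add]_x g x = \int[m1]_x g x + \int[m2]_x g x.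
Proof.
move=> bg; have i1 := bmf_integrable m1 bg; have i2 := bmf_integrable m2 bg.
rewrite /Rintegral integral_measure_add//.
by rewrite fineD//; exact: integrable_fin_num.
Qed.

End finite_measure_add.

Section minimizer_derivative.
Context {R : realType} {n : nat}.
Local Notation mu := (@lebesgue_measure R).
Variables (a b lam c d : R) (f u : 'I_n -> R -> R).
Variables (pu qu pf qf : 'I_n -> {finite_measure set R -> \bar R}).
Hypotheses (lam0 : 0 < lam) (L2f : L2 `]a, b[%classic f).
Hypotheses (umin : is_minimizer a b lam f u) (ac : a <= c) (db : d <= b).
Hypotheses (du : is_deriv_meas `]c, d[%classic u pu qu).
Hypotheses (df : is_deriv_meas `]c, d[%classic f pf qf).
Local Notation U := `]c, d[%classic.
Local Notation z := (dual_field a b lam f u).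
Local Notation E := (contact z).

(** Regrouping the four positive measures writes u' - f' as the difference P - Q of two finite
    measures. *)
Let P i := finite_measure_add (pu i) (qf i).
Let Q i := finite_measure_add (qu i) (pf i).

Lemma sint_difference i g : bmf g ->
  sint (P i) (Q i) g = sint (pu i) (qu i) g - sint (pf i) (qf i) g.
Proof. by move=> bg; rewrite /sint !Rint_measure_add//; ring. Qed.

Let gI i : R -> R := (fun x => u i x - f i x) \_ `]a, b[%classic.

Let UI : U `<=` (`]a, b[%classic : set R).
Proof. exact: (itv_sub_I ac db (lexx _) (lexx _)). Qed.

Lemma difference_weak i phi : Cc1 U phi ->
  \int[mu]_x (gI i x * derive1 phi x) = - sint (P i) (Q i) phi.
Proof.
move=> cphi; have [bphi bd] := Cc1_bmf cphi.
have iu : intI a b (fun x => u i x * derive1 phi x).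
  by apply: intI_bmfMr => //; apply: sqI_int; apply: L2_sqI; exact: umin.1.
have ifi : intI a b (fun x => f i x * derive1 phi x).
  by apply: intI_bmfMr => //; apply: sqI_int; exact: L2_sqI.
have eu := deriv_measE i du cphi; have ef := deriv_measE i df cphi.
rewrite -(Rint_sub_Cc1 _ UI cphi) in eu; rewrite -(Rint_sub_Cc1 _ UI cphi) in ef.
rewrite -rint_gI sint_difference// opprB addrC -eu.
rewrite -[X in _ = _ + X]opprK -ef -rintB//.
by congr Rintegral; apply/funext => x; rewrite mulrBl.
Qed.

(** Test the weak equation with smoothed hats. In the limit their derivatives become weighted
    indicators of ]x1, x2] and ]y1, y2], against which u - f integrates to increments of lam z. *)
Lemma dual_field_slopeE i (x1 x2 y1 y2 : R) : c < x1 -> x1 < x2 -> x2 <= y1 ->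
  y1 < y2 -> y2 < d ->
  slope z i x1 x2 - slope z i y1 y2 =
  - lam^-1 * sint (P i) (Q i) (hat x1 x2 y1 y2).
Proof.
move=> cx x12 xy y12 yd.
have [phi [M [cphi phiM cvphi cvdphi]]] := hat_approximation x12 xy y12 yd.
pose g x : R := ((x1 < x)%R%:R - (x2 < x)%R%:R) / (x2 - x1) -
       ((y1 < x)%R%:R - (y2 < x)%R%:R) / (y2 - y1).
have ig := gI_int L2f umin i; rewrite -/(gI i) in ig.
have mgI : measurable_fun setT (gI i) by apply/measurable_EFinP; case/integrableP: ig.
have bphi k : bmf (phi k) /\ bmf (derive1 (phi k)) by exact: Cc1_bmf (cphi c k cx).
have c1 : \int[mu]_x (gI i x * derive1 (phi k) x) @[k --> \oo] -->
    \int[mu]_x (gI i x * g x).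
  apply: (@cvg_Rintegral _ _ _ mu setT (fun k x => gI i x * derive1 (phi k) x)
    (fun x => gI i x * g x) (fun x => `|gI i x| * M)) => //.
  - by move=> k; apply: measurable_funM => //; have [_ []] := bphi k.
  - apply: (intT_bmfMr (g := fun x => `|gI i x|)); last exact: bmf_cst.
    exact: (integrable_abse ig).
  - by move=> k x _; rewrite normrM ler_wpM2l//; have [] := phiM k x.
  - by move=> x _; apply: cvgM; [exact: cvg_cst|exact: cvdphi].
have c2 : - sint (P i) (Q i) (phi k) @[k --> \oo] -->
    - sint (P i) (Q i) (hat x1 x2 y1 y2).
  apply: cvgN; apply: (@sint_cvg _ _ _ _ _ M) => //.
  - by move=> k; have [[]] := bphi k.
  - by move=> k x; have [] := phiM k x.
have e : \int[mu]_x (gI i x * g x) = - sint (P i) (Q i) (hat x1 x2 y1 y2).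
  have eqk : (fun k => \int[mu]_x (gI i x * derive1 (phi k) x)) =
      (fun k => - sint (P i) (Q i) (phi k)).
    by apply/funext => k; exact: difference_weak (cphi c k cx).
  by rewrite eqk in c1; exact: (cvg_unique _ c1 c2).
have ind (x y w : R) : x < y -> (x < w)%R%:R - (y < w)%R%:R = \1_(`]x, y]%classic) w :> R.
  move=> xy'; rewrite indicE mem_setE in_itv/= [w <= y]leNgt.
  have [yw|wy] := ltP y w; first by rewrite (lt_trans xy' yw) subrr.
  by rewrite subr0 andbT.
have bi (x y : R) : bmf (\1_(`]x, y]%classic) : R -> R).
  by apply: bmf_indic; exact: measurable_itv.
have intE (x y : R) : x < y -> \int[mu]_w (gI i w * \1_(`]x, y]%classic) w) =
    lam * (z i y - z i x).
  move=> xy'; transitivity (\int[mu]_(w in `]x, y]) gI i w).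
    rewrite [RHS]Rintegral_mkcond; apply: eq_Rintegral => w _.
    by rewrite patch_indic.
  rewrite -(tailB ig (ltW xy')) /dual_field -/(gI i).
  by field; rewrite gt_eqF.
move: e.
have -> : \int[mu]_x (gI i x * g x) =
   lam * (z i x2 - z i x1) * (x2 - x1)^-1 - lam * (z i y2 - z i y1) * (y2 - y1)^-1.
  rewrite -!intE//.
  have i1 := intT_bmfMr ig (bi x1 x2); have i2 := intT_bmfMr ig (bi y1 y2).
  rewrite -!RintegralZr// -RintegralB//.
  - by apply: eq_Rintegral => x _; rewrite /g !ind//; ring.
  - exact: (intT_bmfMr i1 (bmf_cst _)).
  - exact: (intT_bmfMr i2 (bmf_cst _)).
move=> e; rewrite mulNr -mulrN -e /slope.
by field; rewrite !subr_eq0 !gt_eqF.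
Qed.

(** This is the sign of z . (u' - f') = lam z . z'' on the contact set. *)
Lemma contact_comparison B : measurable B -> B `<=` U ->
  vint pu qu (restr z (B `&` E)) <= vint pf qf (restr z (B `&` E)).
Proof.
move=> mB BU.
have cz := dual_field_continuous L2f umin.
have z1 := dual_field_le1 lam0 L2f umin.
have il0 : 0 < lam^-1 by rewrite invr_gt0.
have mE : measurable E by apply: closed_measurable; exact: closed_contact cz.
have := vint_contact_le0 il0 cz z1 dual_field_slopeE mB BU.
have bz := dual_field_bmf lam0 L2f umin.
have br : forall i, bmf (restr z (B `&` E) i).
  by apply: bmf_restr => //; exact: measurableI.
rewrite /vint; under eq_bigr do rewrite sint_difference//.
by rewrite sumrB subr_le0.
Qed.

End minimizer_derivative.

(** * A calibrated measure is concentrated on the contact set *)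

Section calibrated_measures.
Context {R : realType} {n : nat}.
Variables (z : 'I_n -> R -> R) (U : set R).
Variables (P Q : 'I_n -> {finite_measure set R -> \bar R}).
Hypotheses (bz : forall i, bmf (z i)).
(** Optimizing over [e] turns this into |(P - Q)(B)| <= int_B z . d(P - Q), a form of the polar
    decomposition tested on sets. *)
Hypothesis calib : forall B (e : 'I_n -> R), measurable B -> B `<=` U ->
  \sum_i e i ^+ 2 <= 1 ->
  \sum_i e i * vmeas P Q B i <= vint P Q (restr z B).
Local Notation E := (contact z).
Local Notation calibration B := (vint P Q (restr z B)).

Lemma calibration_ge0 B : measurable B -> B `<=` U -> 0 <= calibration B.
Proof.
move=> mB BU; have := @calib B (fun=> 0) mB BU.
under eq_bigr do rewrite expr0n.
by rewrite !big1 ?ler01//; [exact|move=> i _; rewrite mul0r].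
Qed.

Lemma enorm_le_calibration B : measurable B -> B `<=` U ->
  enorm (vmeas P Q B) <= calibration B.
Proof. by move=> mB BU; have [e [e1 <-]] := enorm_dual (vmeas P Q B); exact: calib. Qed.

Lemma tvmeas_le_calibration A : measurable A -> A `<=` U ->
  (tvmeas P Q A <= (calibration A)%:E)%E.
Proof.
move=> mA AU; apply: tvmeas_le => B K mB tB UB; rewrite lee_fin.
have BA k : B k `<=` A by rewrite -UB => x Bx; exists k.
have BU k : B k `<=` U := subset_trans (BA k) AU.
have sm := vint_smeas P Q bz.
pose V := \big[setU/set0]_(k < K) B k.
have mV : measurable V by apply: bigsetU_measurable => k _.
have VA : V `<=` A by rewrite /V -bigcup_mkord => x [k _ Bx]; exact: BA Bx.
(* Finitely many cells need not cover [A]; the remainder contributes a nonnegative calibration. *)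
have -> : calibration A = calibration V + calibration (A `\` V).
  rewrite -sm.1 ?setDIK//; last exact: measurableD.
  by rewrite setDUK.
rewrite (smeas_bigsetU K sm mB tB) -[X in X <= _]addr0; apply: lerD.
  by apply: ler_sum => k _; exact: enorm_le_calibration.
apply: calibration_ge0; first exact: measurableD.
by apply: subset_trans AU; exact: subDsetl.
Qed.

(* z / r is still admissible on B, so calibration B <= r * calibration B. *)
Lemma calibration_le0_interior B (r : R) : measurable B -> B `<=` U ->
  0 < r -> r < 1 -> (forall x, B x -> \sum_i z i x ^+ 2 <= r ^+ 2) ->
  calibration B <= 0.
Proof.
move=> mB BU r0 r1 zr.
have bzB : forall i, bmf (restr z B i) by exact: bmf_restr.
pose w i x : R := r^-1 * restr z B i x.
have bw i : bmf (w i) by exact: bmfZ.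
have w1 x : \sum_i w i x ^+ 2 <= 1.
  under eq_bigr do rewrite /w exprMn.
  rewrite -mulr_sumr exprVn ler_pdivrMl ?exprn_gt0// mulr1.
  have [Bx|nB] := pselect (B x).
    apply: le_trans (zr x Bx); apply: ler_sum => i _.
    by rewrite /restr indicE mem_set// mulr1.
  rewrite big1 ?sqr_ge0// => i _.
  by rewrite /restr indicE memNset// mulr0 expr0n.
have := vint_le_tvmeas P Q bw mB w1.
move=> /le_trans/(_ (tvmeas_le_calibration mB BU)); rewrite lee_fin.
have -> : vint P Q (restr w B) = r^-1 * calibration B.
  rewrite -vintZ//; congr vint; apply/funext => i; apply/funext => x.
  rewrite /restr /w /restr indicE; case: (x \in B); rewrite ?mulr1// !mulr0//.
rewrite ler_pdivrMl// => h.
have : (1 - r) * calibration B <= 0 by rewrite mulrBl mul1r subr_le0.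
by rewrite pmulr_rle0 ?subr_gt0.
Qed.

(** Outside the contact set |z| < 1, so that part of [B] is exhausted by the sets where |z| <= r
    with r < 1, and the calibration is nonpositive on each. *)
Lemma calibration_contact B : (forall x, \sum_i z i x ^+ 2 <= 1) ->
  measurable E -> measurable B -> B `<=` U ->
  calibration B <= calibration (B `&` E).
Proof.
move=> z1 mE mB BU.
have sm := vint_smeas P Q bz.
have -> : calibration B = calibration (B `&` E) + calibration (B `\` E).
  rewrite -sm.1.
  - by rewrite setUIDK.
  - exact: measurableI.
  - exact: measurableD.
  - by rewrite -subset0 => x [[_ Ex] [_]].
rewrite gerDl -oppr_ge0.
(* The index [k.+2] keeps the radius positive already for k = 0. *)
pose r k : R := 1 - k.+2%:R^-1.
have r0 k : 0 < r k by rewrite subr_gt0 invf_lt1 ?ltr0n// ltr1n.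
have r1 k : r k < 1 by rewrite gtrBl invr_gt0 ltr0n.
have mS k : measurable [set x | \sum_i z i x ^+ 2 <= r k ^+ 2].
  have bs : bmf (fun x => \sum_i z i x ^+ 2).
    by apply: bmf_sum => i; under eq_fun do rewrite expr2; exact: bmfM.
  have := @measurable_fun_le _ _ R setT (fun x => \sum_i z i x ^+ 2)
    (cst (r k ^+ 2)) measurableT bs.1 (measurable_cst _).
  by rewrite setTI.
pose F k := (B `\` E) `&` [set x | \sum_i z i x ^+ 2 <= r k ^+ 2].
have mF k : measurable (F k) by apply: measurableI => //; exact: measurableD.
apply: (@smeas_ge0_limit _ _ F _ (smeasN sm)) => //; first exact: measurableD.
  move=> x; have [[Bx nE]|nBE] := pselect ((B `\` E) x); last first.
    by exists 0%N => k _; split=> // -[].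
  pose q := \sum_i z i x ^+ 2.
  have q1 : q < 1.
    by rewrite lt_neqAle z1 andbT; apply/eqP => q1; exact: nE.
  (* With r = 1 - e one has r^2 >= 1 - 2 e, so e < (1 - q) / 2 suffices. *)
  have [K hK] := @harmonic_lt _ ((1 - q) / 2) ltac:(by rewrite divr_gt0 ?subr_gt0).
  exists K => k Kk; split=> [[]//|_]; split=> //=; rewrite -/q.
  have := hK k.+1 (leqW Kk); rewrite /r; set e := _^-1 => he.
  have e0 : 0 <= e by rewrite invr_ge0.
  rewrite sqrrB expr1n mul1r; have := sqr_ge0 e; lra.
move=> k; rewrite oppr_ge0; apply: (calibration_le0_interior (mF k) _ (r0 k) (r1 k)).
  by move=> x [[Bx _] _]; exact: BU.
by move=> x [].
Qed.

End calibrated_measures.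

Theorem mainTheorem1 (R : realType) (n : nat) (a b lam c d : R)
  (f u : 'I_n -> R -> R) :
  (0 < n)%N -> a < b -> 0 < lam ->
  L2 `]a, b[%classic f ->
  is_minimizer a b lam f u ->
  a <= c -> d <= b ->
  (exists p q, is_deriv_meas `]c, d[%classic f p q) ->
  forall (pu qu pf qf : 'I_n -> {finite_measure set R -> \bar R}),
    is_deriv_meas `]c, d[%classic u pu qu ->
    is_deriv_meas `]c, d[%classic f pf qf ->
    forall A : set R, measurable A -> A `<=` `]c, d[%classic ->
      (tvmeas pu qu A <= tvmeas pf qf A)%E.
Proof.
move=> _ _ lam0 L2f umin ac db _ pu qu pf qf du df A mA AU.
pose z := dual_field a b lam f u.
have bz : forall i, bmf (z i) := dual_field_bmf lam0 L2f umin.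
have z1 : forall x, \sum_i z i x ^+ 2 <= 1 := dual_field_le1 lam0 L2f umin.
have mE : measurable (contact z).
  apply: closed_measurable; apply: closed_contact.
  exact: dual_field_continuous L2f umin.
have calib B e := @dual_field_calibrates _ _ _ _ _ _ _ lam0 L2f umin _ _ _ _ ac db du B e.
apply: tvmeas_le => B K mB tB UB.
have BU k : B k `<=` `]c, d[%classic.
  by apply: subset_trans AU; rewrite -UB => x Bx; exists k.
have smf := smeas_setI mE (vint_smeas pf qf bz).
pose V := \big[setU/set0]_(k < K) B k.
have mV : measurable V by apply: bigsetU_measurable => k _.
have VA : V `<=` A by rewrite /V -bigcup_mkord -UB => x [k _ Bx]; exists k.
(* On each cell the chain |u'(B k)| <= int z . u' <= int over contact of z . u' <= int over contact
   of z . f' applies, and the last integrals add up over the finite union [V]. *)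
apply: (@le_trans _ _ (vint pf qf (restr z (V `&` contact z)))%:E).
  rewrite lee_fin (smeas_bigsetU K smf mB tB); apply: ler_sum => k _.
  apply: le_trans (enorm_le_calibration calib (mB k) (BU k)) _.
  apply: le_trans (calibration_contact bz calib z1 mE (mB k) (BU k)) _.
  exact: (contact_comparison lam0 L2f umin ac db du df (mB k) (BU k)).
have mVE : measurable (V `&` contact z) by exact: measurableI.
(* Cut off outside V and the contact set, z still has norm at most 1, so it may be tested against f'
   on the whole of [A]. *)
have -> : restr z (V `&` contact z) = restr (restr z (V `&` contact z)) A.
  apply/funext => i; apply/funext => x; rewrite /restr -mulrA; congr (_ * _).
  rewrite !indicE; have [/set_mem[Vx _]|_] := boolP (x \in _ `&` _).
    by rewrite mem_set ?mulr1//; exact: VA.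
  by rewrite mul0r.
apply: vint_le_tvmeas => //; first exact: bmf_restr.
move=> x; apply: le_trans (z1 x); apply: ler_sum => i _.
rewrite /restr indicE; case: (x \in _); rewrite ?mulr1//.
by rewrite mulr0 expr0n sqr_ge0.
Qed.
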